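(* Let $T$ be a 2-element subset of $S_3$ and consider $S_n(T)$ with the uniform probability measure; let $\mathrm{LAS}_n(\sigma)$ be the length of the longest alternating subsequence of $\sigma$. Then: (a) If $T=\{132,321\}$, then $\mathrm{LAS}_n(\sigma)\leq 3$ for every $\sigma\in S_n(T)$. (b) If $T=\{132,231\}$, then $\mathrm{LAS}_n(\sigma)\leq 3$ for every $\sigma\in S_n(T)$. If $T=\{132,312\}$, then $\mathrm{LAS}_n$ is asymptotically normal, with mean $\mathbb{E}^T_n(\mathrm{LAS}_n)\sim n/2$ and standard deviation $\mathrm{SD}^T_n(\mathrm{LAS}_n)\sim\sqrt n/2$. (c) If $T=\{132,123\}$, then $\mathrm{LAS}_n$ is asymptotically normal, with mean $\sim n/2$ and standard deviation $\sim\sqrt n/2$. (d) If $T=\{132,213\}$, then $\mathrm{LAS}_n$ is asymptotically normal, with mean $\sim n/2$ and standard deviation $\sim\sqrt n/2$.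
   Context: $S_n(T)$ is the set of permutations of $[n]$ avoiding every pattern in $T$. A subsequence $\sigma_{i_1}\sigma_{i_2}\cdots\sigma_{i_m}$ ($i_1<\dots<i_m$) is alternating if $\sigma_{i_1}>\sigma_{i_2}<\sigma_{i_3}>\sigma_{i_4}\cdots$. $\mathbb{E}^T_n$, $\mathrm{SD}^T_n$ are the expectation and standard deviation under the uniform measure on $S_n(T)$. ''Asymptotically normal'' means $(\mathrm{LAS}_n-\mathbb{E}^T_n\mathrm{LAS}_n)/\mathrm{SD}^T_n(\mathrm{LAS}_n)$ converges in distribution to a standard normal. $a_n\sim b_n$ means $a_n/b_n\to1$. *)

(* Defs.v *)
From HB Require Import structures.
From mathcomp Require Import all_boot all_order all_algebra all_fingroup.
From mathcomp Require Import all_classical all_reals all_analysis.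

Set Implicit Arguments.
Unset Strict Implicit.
Unset Printing Implicit Defensive.

Import Order.TTheory GRing.Theory Num.Theory.
Import numFieldNormedType.Exports.

Local Open Scope ring_scope.

(* Permutations of [n] are represented by 'S_n: positions and values are
   shifted down by one, ranging over 0, ..., n-1. *)

(* The permutation t_0 t_1 ... t_{n-1} in one-line notation. *)
Definition oneline (n : nat) (t : n.-tuple 'I_n) (ut : uniq t) : 'S_n :=
  perm (elimT (tuple_uniqP t) ut).

(* The values 1, 2, 3 of the usual notation for patterns of length 3. *)
Definition v1 : 'I_3 := @Ordinal 3 0 isT.
Definition v2 : 'I_3 := @Ordinal 3 1 isT.
Definition v3 : 'I_3 := @Ordinal 3 2 isT.

Definition p123 : 'S_3 := @oneline 3 [tuple v1; v2; v3] isT.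
Definition p132 : 'S_3 := @oneline 3 [tuple v1; v3; v2] isT.
Definition p213 : 'S_3 := @oneline 3 [tuple v2; v1; v3] isT.
Definition p231 : 'S_3 := @oneline 3 [tuple v2; v3; v1] isT.
Definition p312 : 'S_3 := @oneline 3 [tuple v3; v1; v2] isT.
Definition p321 : 'S_3 := @oneline 3 [tuple v3; v2; v1] isT.

Definition contains (n k : nat) (s : 'S_n) (p : 'S_k) : bool :=
  [exists f : {ffun 'I_k -> 'I_n},
     [forall a : 'I_k, forall b : 'I_k, (a < b)%N ==> (f a < f b)%N] &&
     [forall a : 'I_k, forall b : 'I_k,
        (s (f a) < s (f b))%N == (p a < p b)%N]].

Definition Av (k : nat) (T : {set 'S_k}) (n : nat) : {set 'S_n} :=
  [set s : 'S_n | [forall p in T, ~~ contains s p]]%SET.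

(* w_0 > w_1 < w_2 > w_3 < ... *)
Definition alternating (w : seq nat) : bool :=
  all (fun j => if odd j then (nth 0%N w j < nth 0%N w j.+1)%N
                else (nth 0%N w j.+1 < nth 0%N w j)%N)
      (iota 0 (size w).-1).

(* A subsequence of s is given by its set of positions A; enum A lists the
   positions in increasing order. *)
Definition LAS (n : nat) (s : 'S_n) : nat :=
  (\max_(A : {set 'I_n} | alternating [seq nat_of_ord (s i) | i <- enum A])
     #|A|)%N.

(* The uniform probability measure on a finite set A. *)
Section Uniform.
Variables (R : realType) (X : finType) (A : {set X}).

Definition unif_prob (E : pred X) : R :=
  #|[set x in A | E x]%SET|%:R / #|A|%:R.

Definition unif_mean (f : X -> R) : R := (\sum_(x in A) f x) / #|A|%:R.

Definition unif_sd (f : X -> R) : R :=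
  Num.sqrt (unif_mean (fun x => (f x - unif_mean f) ^+ 2)).

End Uniform.

Section Asymptotics.
Variable R : realType.
Local Open Scope classical_set_scope.

Definition asymp_equiv (a b : nat -> R) : Prop :=
  (fun n => a n / b n) @ \oo --> (1 : R).

(* Convergence in distribution of real random variables with distribution
   functions F n to the law mu: convergence at every continuity point of the
   distribution function of mu. *)
Definition cvg_in_distribution (F : nat -> R -> R) (mu : set R -> \bar R) :
    Prop :=
  let G := fun x : R => fine (mu `]-oo, x]) in
  forall x : R, {for x, continuous G} -> (fun n => F n x) @ \oo --> G x.

Section LAS.
Variable T : {set 'S_3}.

Definition LASr (n : nat) (s : 'S_n) : R := (LAS s)%:R.

Definition mean_LAS (n : nat) : R := unif_mean (Av T n) (@LASr n).

Definition sd_LAS (n : nat) : R := unif_sd (Av T n) (@LASr n).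

Definition LAS_asymp_normal : Prop :=
  cvg_in_distribution
    (fun n x => unif_prob R (Av T n)
                  (fun s => (LASr s - mean_LAS n) / sd_LAS n <= x))
    (normal_prob 0 1).

End LAS.
End Asymptotics.

(* Main.v *)
(**
  The length of the longest alternating subsequence of a nonempty word is one
  plus the number of direction changes of its ascent/descent word, preceded by
  an ascent. If [T] contains 132 and one of 312, 123, 213, then every
  permutation in [Av T n.+1] extends in exactly two ways to [Av T n.+2] by
  inserting one letter (at the end for 312, at the front otherwise), and the two
  extensions can be labelled 0 and 1 so that some statistic at bounded distance
  from [LAS] grows by the label. Hence [LAS] is a binomial variable of parameters
  [n] and 1/2 up to a bounded error. For 321 and 231, four letters
  [w0 > w1 < w2 > w3] always contain a forbidden pattern.

  The central limit theorem for the binomial law [p] comes from Stein's equation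
  [f' = x f + c]. Since [(n - k) p k = (k + 1) p (k + 1)], the discretised
  equation summed up to a cut [K] telescopes to a boundary term. With
  [f = cdf / pdf], [c = 1] on the left of the cut and [f = (1 - cdf) / pdf],
  [c = -1] on its right, the boundary terms have the same coefficient, so the
  two tail probabilities are in the ratio [cdf : 1 - cdf] up to [O(1 / sqrt n)].
*)

Require Import Defs.
From HB Require Import structures.
From mathcomp Require Import all_boot all_order all_algebra all_fingroup.
From mathcomp Require Import all_classical all_reals all_analysis.
From mathcomp Require Import ring lra zify.

Set Implicit Arguments.
Unset Strict Implicit.
Unset Printing Implicit Defensive.

Import Order.TTheory GRing.Theory Num.Theory.
Import numFieldNormedType.Exports.

Local Open Scope ring_scope.

(** * The normal law and the binomial central limit theorem *)

Section StandardNormal.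
Variable R : realType.
Implicit Types x y M : R.

Definition gauss_pdf : R -> R := normal_pdf 0 1.

(** Spelled as the limit function [G] of [cvg_in_distribution], to which it is convertible. *)
Definition gauss_cdf x : R := fine (normal_prob 0 1 `]-oo, x]%classic).

Lemma gauss_pdfE x : gauss_pdf x = normal_peak 1 * expR (- (x ^+ 2 / 2)).
Proof.
rewrite /gauss_pdf normal_pdfE ?oner_neq0// /normal_fun subr0 expr1n.
by rewrite mulNr.
Qed.

Lemma gauss_pdf_gt0 x : 0 < gauss_pdf x.
Proof. by rewrite gauss_pdfE mulr_gt0 ?expR_gt0// normal_peak_gt0 ?oner_neq0. Qed.

Lemma gauss_pdf_neq0 x : gauss_pdf x != 0.
Proof. by rewrite gt_eqF// gauss_pdf_gt0. Qed.

Lemma gauss_pdfN x : gauss_pdf (- x) = gauss_pdf x.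
Proof. by rewrite !gauss_pdfE sqrrN. Qed.

Lemma gauss_pdf_le1 x : gauss_pdf x <= 1.
Proof.
apply: (le_trans (normal_pdf_ub _ _ (oner_neq0 _))).
have pi2 := pi_ge2 R; have pi0 : 0 < pi *+ 2 :> R by rewrite mulrn_wgt0 ?pi_gt0.
rewrite /normal_peak expr1n mul1r invf_le1 ?sqrtr_gt0//.
rewrite -[leLHS]sqrtr1 ler_wsqrtr// mulr2n.
by lra.
Qed.

Lemma gauss_pdf_lower M x : `|x| <= M -> gauss_pdf M <= gauss_pdf x.
Proof.
move=> xM; rewrite !gauss_pdfE ler_wpM2l ?normal_peak_ge0// ler_expR lerN2.
have M0 : 0 <= M by rewrite (le_trans _ xM).
rewrite ler_wpM2r ?invr_ge0// -[x ^+ 2]real_normK ?num_real// lerXn2r// nnegrE.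
Qed.

Lemma is_derive_gauss_pdf x : is_derive x 1 gauss_pdf (- (x * gauss_pdf x)).
Proof.
have -> : gauss_pdf = normal_peak 1 \*: (expR \o (fun y => - (y ^+ 2 / 2))).
  by apply/funext => y; rewrite gauss_pdfE.
apply: is_derive_eq; rewrite /= /GRing.scale /= /GRing.scale/=.
by field.
Qed.

Lemma is_derive_gauss_cdf x : is_derive x 1 gauss_cdf (gauss_pdf x).
Proof.
have [] := @continuous_FTC1 R gauss_pdf -oo%O x (x + 1).
- by rewrite ltrDl.
- apply: (@integrableS _ _ _ _ setT) => //.
  exact: integrable_normal_pdf.
- exact: ltNyr.
- exact: continuous_normal_pdf (oner_neq0 _) _.
move=> dF eF; apply: DeriveDef; first exact: dF.
by rewrite -derive1E -[RHS]eF.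
Qed.

(** The identity is a random variable under the normal law with distribution function [gauss_cdf],
    so bounds and limits of [cdf] transfer to it. *)
Let idR : measurableTypeR R -> R := idfun.

HB.instance Definition _ :=
  @isMeasurableFun.Build _ _ _ _ idR (@measurable_id _ _ setT).

Let X : {RV (normal_prob 0 1 : probability _ R) >-> R} := idR.

Let cdfE x : cdf X x = (gauss_cdf x)%:E.
Proof. by rewrite /gauss_cdf fineK// fin_num_measure. Qed.

Lemma gauss_cdf_ge0 x : 0 <= gauss_cdf x.
Proof. by rewrite -lee_fin -cdfE cdf_ge0. Qed.

Lemma gauss_cdf_le1 x : gauss_cdf x <= 1.
Proof. by rewrite -lee_fin -cdfE cdf_le1. Qed.

Lemma gauss_cdf_cvgNy : (gauss_cdf x @[x --> -oo] --> 0)%classic.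
Proof.
have := @cvg_cdfNy0 _ _ _ _ X; under eq_cvg do rewrite cdfE.
by move/fine_cvg.
Qed.

Lemma gauss_cdf_cvgy : (gauss_cdf x @[x --> +oo] --> (1 : R))%classic.
Proof.
have := @cvg_cdfy1 _ _ _ _ X; under eq_cvg do rewrite cdfE.
by move/fine_cvg.
Qed.

(* Mills' bound; it is stated for an arbitrary antiderivative [H] so as to apply
   both to the left tail and to the reflected right tail. *)
Lemma mills (H : R -> R) :
  (forall x, is_derive x 1 H (gauss_pdf x)) ->
  (H x @[x --> -oo] --> 0)%classic ->
  forall x, x < 0 -> - x * H x <= gauss_pdf x.
Proof.
move=> dH H0 x x0.
(* [D] is the gap in the bound divided by [- y]; its derivative is positive and its limit at [-oo]
   is nonnegative, so [D x >= 0]. *)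
pose D y := - (gauss_pdf y / y) - H y.
have dD y : y < 0 -> is_derive y 1 D (gauss_pdf y / y ^+ 2).
  move=> y0; have yn0 : y != 0 by rewrite lt_eqF.
  have dphi := is_derive_gauss_pdf y.
  have dHy := dH y.
  have dV : is_derive y 1 (fun z : R => z^-1) (- (y ^- 2)).
    apply: is_derive_eq; first exact: is_deriveV.
    by rewrite /GRing.scale/= mulr1.
  apply: is_derive_eq; rewrite /GRing.scale/=.
  by field.
have Dmono y : y < x -> D y <= D x.
  move=> yx.
  have [] := @MVT R D (fun y => gauss_pdf y / y ^+ 2) y x yx.
  - move=> z; rewrite in_itv/= => /andP[_ zx]; apply: dD; exact: lt_trans zx x0.
  - apply: derivable_within_continuous => z; rewrite in_itv/= => /andP[_ zx].
    by have [] := dD z (le_lt_trans zx x0).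
  move=> c _ /eqP; rewrite subr_eq => /eqP ->; rewrite lerDr mulr_ge0//.
    by rewrite divr_ge0 ?sqr_ge0// ltW// gauss_pdf_gt0.
  by rewrite subr_ge0 ltW.
have D0 : 0 <= D x.
  apply/ler_addgt0Pr => e e0.
  have /cvgrPdist_lt/(_ e e0) := H0.
  move=> [M [_ MP]].
  pose y := Num.min (M - 1) (x - 1).
  have yx : y < x by rewrite /y gt_min; apply/orP; right; rewrite ltrBlDr ltrDl.
  have yM : y < M by rewrite /y gt_min; apply/orP; left; rewrite ltrBlDr ltrDl.
  have := MP _ yM; rewrite sub0r normrN => He.
  rewrite -lerBlDr (le_trans _ (Dmono _ yx))// /D.
  rewrite lerD// ?lerN2; last first.
    by rewrite (le_trans (ler_norm _)) ?ltW.
  have y0 : y < 0 := lt_trans yx x0.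
  rewrite oppr_ge0 mulr_ge0_le0//; first by rewrite ltW// gauss_pdf_gt0.
  by rewrite invr_le0 ltW.
have -> : gauss_pdf x = - x * H x + (- x) * D x.
  by rewrite /D; field; rewrite lt_eqF.
by rewrite lerDl mulr_ge0// oppr_ge0 ltW.
Qed.

End StandardNormal.

(** * Mills ratios as solutions of Stein's equation, and their finite differences *)

Section MillsRatio.
Variable R : realType.
Implicit Types (x M : R) (H f : R -> R).

Lemma MVT_derive (f df : R -> R) (a b : R) :
  a <= b -> (forall x, is_derive x 1 f (df x)) ->
  exists2 c, a <= c <= b & f b - f a = df c * (b - a).
Proof.
move=> ab dfE; have [|c] := @MVT_segment R f df a b ab.
  by apply: derivable_within_continuous => x _; have [] := dfE x.
by rewrite in_itv/=; exists c.
Qed.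

Definition mills_ratio H x := H x / gauss_pdf x.

(** Stein's equation [f' = x f + 1]: [H' = gauss_pdf] contributes 1 and [gauss_pdf' = - x gauss_pdf]
    contributes [x f]. *)
Lemma is_derive_mills_ratio H : (forall x, is_derive x 1 H (gauss_pdf x)) ->
  forall x, is_derive x 1 (mills_ratio H) (x * mills_ratio H x + 1).
Proof.
move=> dH x; have dHx := dH x; have dp := is_derive_gauss_pdf x.
have pn0 := gauss_pdf_neq0 x.
have dV : is_derive x 1 (fun z => (gauss_pdf z)^-1)
    (- (gauss_pdf x ^- 2) *: - (x * gauss_pdf x)).
  exact: is_deriveV.
rewrite /mills_ratio; apply: is_derive_eq; rewrite /GRing.scale/=.
by field.
Qed.

(** For [x <= -1], [mills] gives [f <= - x f <= 1]. On the bounded rest the density is at least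
    [gauss_pdf M'], whence [f <= Q]. Both [f] and [f'] are bounded because [stein_difference] needs
    both. *)
Lemma mills_ratio_bounded H M :
  (forall x, is_derive x 1 H (gauss_pdf x)) ->
  (H x @[x --> -oo] --> 0)%classic ->
  (forall x, 0 <= H x <= 1) ->
  exists C : R, forall x, x <= M ->
    `|mills_ratio H x| <= C /\ `|x * mills_ratio H x + 1| <= C.
Proof.
move=> dH H0 H01; pose M' := Num.max M 1.
have M'1 : 1 <= M' by rewrite le_max lexx orbT.
have p0 := gauss_pdf_gt0 M'.
have rge0 x : 0 <= mills_ratio H x.
  by rewrite divr_ge0 ?(ltW (gauss_pdf_gt0 x))//; case/andP: (H01 x).
pose Q := (gauss_pdf M')^-1; have Q0 : 0 < Q by rewrite invr_gt0.
exists ((M' + 1) * Q + 2) => x xM; rewrite ger0_norm//.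
suff [r1 r2] : mills_ratio H x <= (M' + 1) * Q + 1 /\
    `|x * mills_ratio H x| <= (M' + 1) * Q + 1.
  split; first by lra.
  by apply: (le_trans (ler_normD _ _)); rewrite normr1; lra.
have Q1 : 0 <= (M' + 1) * Q by rewrite mulr_ge0 ?(ltW Q0)//; lra.
have [xn1|xn1] := leP x (-1).
  have x0 : x < 0 by lra.
  have rx : - x * mills_ratio H x <= 1.
    rewrite /mills_ratio mulrA ler_pdivrMr ?gauss_pdf_gt0// mul1r.
    exact: mills.
  have := rge0 x => r0; rewrite normrM (ltr0_norm x0) (ger0_norm r0).
  split; last by lra.
  suff : mills_ratio H x <= - x * mills_ratio H x by lra.
  by rewrite ler_peMl//; lra.
have xM' : `|x| <= M'.
  have : x <= M' by rewrite le_max xM.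
  by rewrite ler_norml => ->; rewrite andbT; lra.
have rQ : mills_ratio H x <= Q.
  rewrite /mills_ratio /Q ler_pdivrMr ?gauss_pdf_gt0// mulrC.
  rewrite ler_pdivlMr// (le_trans _ (gauss_pdf_lower xM'))//.
  by rewrite ler_piMl ?(ltW p0)//; case/andP: (H01 x).
have r0 := rge0 x.
split; first by nra.
rewrite normrM (ger0_norm r0) (@le_trans _ _ (M' * Q))//; last by nra.
by rewrite ler_pM.
Qed.

(** The difference quotient is [f' z = z f z + c] for some [z] in the interval; moving [z] to [x]
    and [f z] to the mean of the end values costs [O(d)], since [f] and [f'] are bounded by [C]. *)
Lemma stein_difference f (c d C x : R) : 0 < d ->
  (forall z : R, is_derive z 1 f (z * f z + c)) ->
  (forall z, x <= z <= x + d -> `|f z| <= C /\ `|z * f z + c| <= C) ->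
  `|(f (x + d) - f x) / d - x * (f (x + d) + f x) / 2 - c|
    <= C * d * (1 + `|x|).
Proof.
move=> d0 df fC.
have Lip a b : x <= a -> a <= b -> b <= x + d -> `|f b - f a| <= C * d.
  move=> xa ab bd; have [z /andP[az zb] ->] := MVT_derive ab df.
  have [|f1 f2] := fC z; first by apply/andP; split; lra.
  rewrite normrM ler_pM// ger0_norm; lra.
have [|z /andP[xz zd] fz] := @MVT_derive f (fun z => z * f z + c) x (x + d) _ df.
  by lra.
have -> : (f (x + d) - f x) / d = z * f z + c.
  by rewrite fz addrAC subrr add0r mulfK// gt_eqF.
have -> : z * f z + c - x * (f (x + d) + f x) / 2 - c =
   (z - x) * f z + x * ((f z - f x) / 2 - (f (x + d) - f z) / 2) by field.
have L1 := Lip x z (lexx _) xz zd.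
have L2 := Lip z (x + d) xz zd (lexx _).
have [|f1 f2] := fC z; first by apply/andP.
have -> : C * d * (1 + `|x|) = d * C + `|x| * (C * d) by ring.
apply: (le_trans (ler_normD _ _)); apply: lerD; rewrite normrM.
  by apply: ler_pM => //; rewrite ger0_norm; lra.
apply: ler_wpM2l => //; apply: (le_trans (ler_normB _ _)).
by rewrite !normrM (@ger0_norm _ 2^-1)//; lra.
Qed.

End MillsRatio.

(** * The symmetric binomial law and its Stein identity *)

Section BinomialLaw.
Variable R : realType.
Implicit Types (n k K : nat) (g : nat -> R).

Definition binp n k : R := 'C(n, k)%:R / 2 ^+ n.

Lemma binp_ge0 n k : 0 <= binp n k.
Proof. by rewrite divr_ge0// exprn_ge0. Qed.

Lemma sum_binp n : \sum_(k < n.+1) binp n k = 1.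
Proof.
rewrite -mulr_suml -natr_sum; have -> : (\sum_(k < n.+1) 'C(n, k) = 2 ^ n)%N.
  by rewrite (expnDn 1 1); under [RHS]eq_bigr do rewrite !exp1n !muln1.
by rewrite natrX divff// expf_neq0.
Qed.

Lemma binpS n k : (n%:R - k%:R) * binp n k = k.+1%:R * binp n k.+1.
Proof.
rewrite /binp !mulrA; congr (_ / _).
have [kn|nk] := leqP k n; last by rewrite !bin_small ?mulr0// ltnW.
by rewrite -natrB// -!natrM mul_bin_left.
Qed.

(** By [binpS] the summand is [b k.+1 - b k] with [b k = k * binp n k * g k], and [b 0 = 0]. At
    [K = n] the boundary term vanishes. *)
Lemma sum_binp_stein n K g :
  \sum_(k < K.+1) binp n k * ((n%:R - k%:R) * g k.+1 - k%:R * g k) =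
  (n%:R - K%:R) * binp n K * g K.+1.
Proof.
elim: K => [|K IH]; first by rewrite big_ord1 /=; ring.
rewrite big_ord_recr/= {}IH binpS; ring.
Qed.

Lemma sum_binp_mean n : \sum_(k < n.+1) binp n k * (k%:R *+ 2 - n%:R) = 0.
Proof.
apply/eqP; rewrite -oppr_eq0 -sumrN; apply/eqP.
have := sum_binp_stein n n (fun=> 1); rewrite subrr !mul0r => {2}<-.
by apply: eq_bigr => k _; ring.
Qed.

Lemma sum_binp_var n :
  \sum_(k < n.+1) binp n k * (k%:R *+ 2 - n%:R) ^+ 2 = n%:R.
Proof.
(* This choice of [g] makes the Stein summand equal to [n - (2 k - n) ^ 2]. *)
have := sum_binp_stein n n (fun k => k%:R *+ 2 - n%:R - 1).
rewrite subrr !mul0r => S0.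
have : \sum_(k < n.+1) binp n k * (n%:R - (k%:R *+ 2 - n%:R) ^+ 2) = 0.
  by rewrite -[RHS]S0; apply: eq_bigr => k _; rewrite -natr1; ring.
under eq_bigr do rewrite mulrBr.
by rewrite sumrB -mulr_suml sum_binp mul1r => /eqP; rewrite subr_eq0 => /eqP.
Qed.

End BinomialLaw.

(** * The central limit theorem for the binomial law, with rate [1 / sqrt n] *)

Section DeMoivreLaplace.
Variable R : realType.
Implicit Types (n k K : nat) (x y M C : R) (f : R -> R).

Local Notation step n := (2 / Num.sqrt n%:R : R).

(** The standardised value of [k]: the binomial law has mean [n / 2] and standard deviation
    [sqrt n / 2]. *)
Definition grid n k : R := (k%:R *+ 2 - n%:R) / Num.sqrt n%:R.

Lemma gridS n k : grid n k.+1 = grid n k + step n.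
Proof. by rewrite /grid -natr1 -mulrDl; congr (_ / _); ring. Qed.

(** Substituting [k = (n + sqrt n * grid n k) / 2] turns the discrete Stein summand into the
    expression estimated by [stein_difference] with [d = step n]. *)
Lemma stein_grid n k f : (0 < n)%N ->
  ((n%:R - k%:R) * f (grid n k.+1) - k%:R * f (grid n k)) / Num.sqrt n%:R =
  (f (grid n k + step n) - f (grid n k)) / step n
    - grid n k * (f (grid n k + step n) + f (grid n k)) / 2.
Proof.
move=> n0; rewrite gridS.
have r0 : 0 < Num.sqrt n%:R :> R by rewrite sqrtr_gt0 ltr0n.
have rE : n%:R = Num.sqrt n%:R ^+ 2 :> R by rewrite sqr_sqrtr.
set a := f (_ + _); set b := f _.
rewrite /grid {1 4}rE; move: (Num.sqrt _) r0 => r r0.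
by field; rewrite gt_eqF.
Qed.

(** Since [|x| <= (1 + x ^ 2) / 2] and [grid] has second moment 1, the sum is at most
    [1 + (1 + 1) / 2]. *)
Lemma sum_binp_grid_abs n : (0 < n)%N ->
  \sum_(k < n.+1) binp R n k * (1 + `|grid n k|) <= 2.
Proof.
move=> n0.
have n0' : n%:R != 0 :> R by rewrite pnatr_eq0 -lt0n.
have -> : 2 = \sum_(k < n.+1) binp R n k * (1 + (1 + grid n k ^+ 2) / 2).
  have -> : \sum_(k < n.+1) binp R n k * (1 + (1 + grid n k ^+ 2) / 2) =
      \sum_(k < n.+1) (binp R n k * (3 / 2) +
        binp R n k * (k%:R *+ 2 - n%:R) ^+ 2 * (n%:R^-1 / 2)).
    apply: eq_bigr => k _; rewrite /grid expr_div_n sqr_sqrtr//.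
    by field.
  rewrite big_split/= -mulr_suml -[X in _ + X]mulr_suml sum_binp sum_binp_var.
  by field.
apply: ler_sum => k _; apply: ler_wpM2l; first exact: binp_ge0.
rewrite lerD2l; have := sqr_ge0 (`|grid n k| - 1).
by rewrite sqrrB1 real_normK ?num_real//; lra.
Qed.

(** The local errors [C * step n * (1 + |grid n k|)] of [stein_difference] are averaged by
    [sum_binp_grid_abs]. The index set [I] lets [f] be controlled on one side of a cut only. *)
Lemma stein_sum_error n f (c C : R) (I : pred nat) : (0 < n)%N -> 0 <= C ->
  (forall z : R, is_derive z 1 f (z * f z + c)) ->
  (forall k z, I k -> grid n k <= z <= grid n k + step n ->
     `|f z| <= C /\ `|z * f z + c| <= C) ->
  `|(\sum_(k < n.+1 | I k)
       binp R n k * ((n%:R - k%:R) * f (grid n k.+1) - k%:R * f (grid n k)))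
      / Num.sqrt n%:R - c * \sum_(k < n.+1 | I k) binp R n k|
    <= 2 * C * step n.
Proof.
move=> n0 C0 df fC.
have d0 : 0 < step n by rewrite divr_gt0// sqrtr_gt0 ltr0n.
rewrite mulr_suml mulr_sumr -sumrB.
apply: (le_trans (ler_norm_sum _ _ _)).
apply: (@le_trans _ _
    (\sum_(k < n.+1) C * step n * (binp R n k * (1 + `|grid n k|)))); last first.
  rewrite -mulr_sumr -[leRHS]mulrA [leRHS]mulrC ler_wpM2l ?sum_binp_grid_abs//.
  by rewrite mulr_ge0// ltW.
rewrite big_mkcond/=; apply: ler_sum => k _.
case: ifPn => [Ik|_]; last first.
  by rewrite !mulr_ge0 ?binp_ge0 ?addr_ge0// ?(ltW d0)// invr_ge0.
rewrite -mulrA stein_grid// [c * _]mulrC -mulrBr normrM ger0_norm ?binp_ge0//.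
rewrite mulrCA ler_wpM2l ?binp_ge0//.
by apply: stein_difference => // z; apply: fC.
Qed.

(* With [f = cdf / pdf] on the left of [K] and [f = (1 - cdf) / pdf] on the
   right, both truncated Stein sums telescope to the same boundary coefficient;
   eliminating it leaves the distribution function at the cut. *)
Lemma binp_cdf_grid M : exists C, forall n K, (0 < n)%N -> (K <= n)%N ->
  `|grid n K.+1| <= M ->
  `|\sum_(k < n.+1 | (k < K.+1)%N) binp R n k - gauss_cdf (grid n K.+1)|
    <= C / Num.sqrt n%:R.
Proof.
(* The right tail reflected to the left, so that [mills_ratio_bounded] applies to it; [f2] below is
   then [(1 - cdf) / pdf]. *)
pose H y : R := 1 - gauss_cdf (- y).
have dPhi := @is_derive_gauss_cdf R.
have dH y : is_derive y 1 H (gauss_pdf y).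
  have dN : is_derive y 1 (fun z : R => gauss_cdf (- z)) (- gauss_pdf y).
    have dP : is_derive (- y) 1 (@gauss_cdf R) (gauss_pdf (- y)) := dPhi _.
    by apply: is_derive_eq; rewrite gauss_pdfN mulrN1.
  have -> : H = cst 1 - (fun z : R => gauss_cdf (- z)) by [].
  by apply: is_derive_eq; rewrite sub0r opprK.
have H0 : (H x @[x --> -oo] --> 0)%classic.
  rewrite cvgNy_compNP.
  have -> : H \o -%R = (fun y => 1 - gauss_cdf y).
    by apply/funext => y; rewrite /H/= opprK.
  suff : (1 - gauss_cdf x @[x --> +oo] --> (1 - 1 : R))%classic by rewrite subrr.
  by apply: cvgB; [exact: cvg_cst|exact: gauss_cdf_cvgy].
have H01 y : 0 <= H y <= 1.
  by have := gauss_cdf_ge0 (- y); have := gauss_cdf_le1 (- y); rewrite /H; lra.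
have Phi01 (y : R) : 0 <= gauss_cdf y <= 1 by rewrite gauss_cdf_ge0 gauss_cdf_le1.
have [C1 C1P] := mills_ratio_bounded M dPhi (@gauss_cdf_cvgNy R) Phi01.
have [C2 C2P] := mills_ratio_bounded M dH H0 H01.
have C10 : 0 <= C1 by have [+ _] := C1P M (lexx _); apply: le_trans.
have C20 : 0 <= C2 by have [+ _] := C2P M (lexx _); apply: le_trans.
exists (4 * (C1 + C2)) => n K n0 Kn; set x' := grid n K.+1 => x'M.
have r0 : 0 < Num.sqrt n%:R :> R by rewrite sqrtr_gt0 ltr0n.
have grid_le k l : (k <= l)%N -> grid n k <= grid n l.
  move=> kl; rewrite /grid ler_wpM2r ?invr_ge0 ?(ltW r0)//.
  by rewrite lerD2r lerMn2r/= ler_nat.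
pose f1 := mills_ratio (@gauss_cdf R).
pose f2 x := mills_ratio H (- x).
have df1 (z : R) : is_derive z 1 f1 (z * f1 z + 1) by exact: is_derive_mills_ratio.
have df2 (z : R) : is_derive z 1 f2 (z * f2 z + - 1).
  have dm : is_derive (- z) 1 (mills_ratio H) (- z * mills_ratio H (- z) + 1).
    exact: is_derive_mills_ratio.
  by apply: is_derive_eq; rewrite /f2; ring.
pose A := (n%:R - K%:R) * binp R n K / Num.sqrt n%:R.
pose S f (I : pred nat) := \sum_(k < n.+1 | I k)
  binp R n k * ((n%:R - k%:R) * f (grid n k.+1) - k%:R * f (grid n k)).
have S1 f : S f (fun k => (k < K.+1)%N) / Num.sqrt n%:R = A * f x'.
  rewrite /S -(big_ord_widen _ (fun k =>
    binp R n k * ((n%:R - k%:R) * f (grid n k.+1) - k%:R * f (grid n k))))//.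
  by rewrite (sum_binp_stein n K (fun k => f (grid n k))) /A; ring.
(* The sum over all [k <= n] vanishes, so the right part is minus the left one. *)
have S2 f : S f (fun k => ~~ (k < K.+1)%N) / Num.sqrt n%:R = - (A * f x').
  rewrite -S1; apply/eqP; rewrite -addr_eq0 -mulrDl; apply/eqP.
  rewrite addrC /S -(bigID (fun k : 'I_n.+1 => (k < K.+1)%N) xpredT)/=.
  by rewrite (sum_binp_stein n n (fun k => f (grid n k))) subrr !mul0r.
have := @stein_sum_error n f1 1 C1 (fun k => (k < K.+1)%N) n0 C10 df1.
rewrite -/(S _ _) S1 => E1.
have := @stein_sum_error n f2 (-1) C2 (fun k => ~~ (k < K.+1)%N) n0 C20 df2.
rewrite -/(S _ _) S2 => E2.
(* Each solution is evaluated only on the side of the cut where it is bounded: [z <= M] for [f1],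
   and [- z <= M] for [f2]. *)
have {E1} E1 : `|A * f1 x' - 1 * \sum_(k < n.+1 | (k < K.+1)%N) binp R n k|
     <= 2 * C1 * step n.
  apply: E1 => k z kK /andP[_ zk]; apply: C1P; apply: (le_trans zk).
  rewrite -gridS (le_trans (grid_le _ K.+1 _))//.
  exact: le_trans (ler_norm _) x'M.
have {E2} E2 : `|- (A * f2 x') - -1 * \sum_(k < n.+1 | ~~ (k < K.+1)%N) binp R n k|
     <= 2 * C2 * step n.
  apply: E2 => k z kK /andP[zk _].
  have zM : - z <= M.
    apply: le_trans x'M; rewrite -normrN; apply: le_trans (ler_norm _).
    by rewrite lerN2; apply: le_trans zk; apply: grid_le; rewrite leqNgt.
  have [c1 c2] := C2P _ zM; split => //.
  by rewrite /f2 -normrN opprD opprK -mulNr.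
have := sum_binp R n.
rewrite (bigID (fun k : 'I_n.+1 => (k < K.+1)%N))/=.
move: E1 E2; set P1 := \sum_(k < n.+1 | (k < K.+1)%N) _.
set P2 := \sum_(k < n.+1 | ~~ _) _ => E1 E2 P12.
have p0 := gauss_pdf_neq0 x'.
(* Weighted by [cdf] and [1 - cdf], both boundary terms equal [A * cdf * (1 - cdf) / pdf] and
   cancel; [P1 + P2 = 1] does the rest. *)
have -> : P1 - gauss_cdf x' =
   gauss_cdf x' * (- (A * f2 x') - -1 * P2) * -1
   - (1 - gauss_cdf x') * (A * f1 x' - 1 * P1).
  rewrite /f1 /f2 /mills_ratio /H opprK gauss_pdfN.
  have -> : P2 = 1 - P1 by rewrite -P12; ring.
  by field.
apply: (le_trans (ler_normB _ _)).
have -> : 4 * (C1 + C2) / Num.sqrt n%:R = 2 * C2 * step n + 2 * C1 * step n.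
  by field; rewrite gt_eqF.
have /andP[P0 P1'] := Phi01 x'.
apply: lerD; rewrite !normrM.
  rewrite normrN1 mulr1 -[leRHS]mul1r ler_pM// ger0_norm//.
by rewrite -[leRHS]mul1r ler_pM// ger0_norm//; lra.
Qed.

Lemma gauss_cdf_lip x y : x <= y -> `|gauss_cdf y - gauss_cdf x| <= y - x.
Proof.
move=> xy; have [c _ ->] := MVT_derive xy (@is_derive_gauss_cdf R).
rewrite normrM [X in _ * X]ger0_norm ?subr_ge0// ler_piMl ?subr_ge0//.
by rewrite ger0_norm ?gauss_pdf_le1// ltW// gauss_pdf_gt0.
Qed.

(** For an arbitrary cut [y] the sum stops at [K = truncn y], and the standardised cut [t] lies
    within [step n] of [grid n K.+1]; the Lipschitz bound turns this into the extra 2 in the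
    constant. [M ^+ 2 < n] forces [0 <= y < n], hence [K <= n]. *)
Lemma binp_cdf M : exists C, forall n y, (0 < n)%N -> M ^+ 2 < n%:R ->
  `|(y *+ 2 - n%:R) / Num.sqrt n%:R| <= M ->
  `|\sum_(k < n.+1 | k%:R <= y) binp R n k
    - gauss_cdf ((y *+ 2 - n%:R) / Num.sqrt n%:R)| <= C / Num.sqrt n%:R.
Proof.
have [C CP] := binp_cdf_grid (M + 2).
exists (C + 2) => n y n0 nM; set t := _ / _ => tM.
have r0 : 0 < Num.sqrt n%:R :> R by rewrite sqrtr_gt0 ltr0n.
have r1 : 1 <= Num.sqrt n%:R :> R.
  by rewrite -[leLHS]sqrtr1 ler_wsqrtr// ler1n.
have rE : Num.sqrt n%:R ^+ 2 = n%:R :> R by rewrite sqr_sqrtr.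
have M0 : 0 <= M by apply: le_trans tM.
have Mr : M < Num.sqrt n%:R.
  by rewrite -(@ltr_pXn2r _ 2) ?nnegrE ?(ltW r0)// rE.
have yE : y *+ 2 = t * Num.sqrt n%:R + n%:R by rewrite /t divfK ?gt_eqF// subrK.
move: tM; rewrite ler_norml => /andP[tM1 tM2].
have y0 : 0 <= y.
  rewrite -(pmulrn_lge0 _ (isT : (0 < 2)%N)) yE -[X in _ + X]rE expr2 -mulrDl.
  by rewrite mulr_ge0 ?(ltW r0)//; lra.
have yn : y < n%:R.
  rewrite -(ltr_pMn2r (isT : (0 < 2)%N)) yE mulr2n ltrD2r -[ltRHS]rE expr2.
  by rewrite ltr_pM2r// (le_lt_trans tM2).
pose K := Num.truncn y.
have /andP[Ky yK] := truncn_itv y0.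
have Kn : (K <= n)%N by rewrite -(ler_nat R) (le_trans Ky)// ltW.
have -> : \sum_(k < n.+1 | k%:R <= y) binp R n k =
   \sum_(k < n.+1 | (k < K.+1)%N) binp R n k.
  apply: eq_bigl => k; rewrite ltnS; apply/idP/idP => [ky|kK].
    by rewrite -ltnS -(ltr_nat R) (le_lt_trans ky).
  by rewrite (le_trans _ Ky)// ler_nat.
have tg : t <= grid n K.+1 <= t + step n.
  rewrite gridS /grid /t; apply/andP; split.
    rewrite -mulrDl ler_wpM2r ?invr_ge0 ?(ltW r0)//.
    by rewrite -natr1 in yK; lra.
  by rewrite lerD2r ler_wpM2r ?invr_ge0 ?(ltW r0)// lerD2r lerMn2r.
have s2 : step n <= 2 by rewrite ler_pdivrMr// ler_peMr.
have /andP[tg1 tg2] := tg.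
have gM : `|grid n K.+1| <= M + 2 by rewrite ler_norml; apply/andP; split; lra.
have B1 := CP _ _ n0 Kn gM.
have B2 := gauss_cdf_lip tg1.
have -> : (C + 2) / Num.sqrt n%:R = C / Num.sqrt n%:R + step n by rewrite mulrDl.
apply: (le_trans (ler_distD (gauss_cdf (grid n K.+1)) _ _)).
by apply: lerD => //; apply: (le_trans B2); lra.
Qed.

End DeMoivreLaplace.

(** * Uniform means and bounded perturbations *)

Section UniformMean.
Variables (R : realType) (X : finType) (A : {set X}).
Hypothesis A_gt0 : (0 < #|A|)%N.
Implicit Types (f g : X -> R) (c : R).
Local Notation E := (unif_mean A).

Let A0 : 0 < #|A|%:R :> R. Proof. by rewrite ltr0n. Qed.

Lemma unif_mean_cst c : E (fun=> c) = c.
Proof. by rewrite /unif_mean sumr_const -[c *+ _]mulr_natr mulfK// gt_eqF. Qed.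

Lemma unif_meanD f g : E (fun x => f x + g x) = E f + E g.
Proof. by rewrite /unif_mean big_split mulrDl. Qed.

Lemma unif_meanZ c f : E (fun x => c * f x) = c * E f.
Proof. by rewrite /unif_mean -mulr_sumr mulrA. Qed.

Lemma ler_unif_mean f g : {in A, forall x, f x <= g x} -> E f <= E g.
Proof. by move=> fg; rewrite ler_pM2r ?invr_gt0// ler_sum. Qed.

Lemma unif_mean_dist f g c : {in A, forall x, `|f x - g x| <= c} ->
  `|E f - E g| <= c.
Proof.
move=> fg; have -> : E f - E g = E (fun x => f x - g x).
  by rewrite /unif_mean -mulrBl -sumrB.
rewrite ler_norml -{1}(unif_mean_cst (- c)) -{2}(unif_mean_cst c).
by apply/andP; split; apply: ler_unif_mean => x /fg; rewrite ler_norml => /andP[].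
Qed.

Lemma unif_probE (P : pred X) : unif_prob R A P = E (fun x => (P x)%:R).
Proof.
rewrite /unif_prob /unif_mean; congr (_ / _).
rewrite -sum1_card natr_sum big_mkcond [RHS]big_mkcond.
by apply: eq_bigr => x _; rewrite inE; case: (x \in A); case: (P x).
Qed.

Lemma ler_unif_prob (P Q : pred X) : {in A, forall x, P x -> Q x} ->
  unif_prob R A P <= unif_prob R A Q.
Proof.
move=> PQ; rewrite !unif_probE; apply: ler_unif_mean => x /PQ.
by case: (P x) => [->|]//.
Qed.

(* The cross term [2 y z] is bounded by AM-GM with weight [r], to be taken of the
   order of the standard deviation. *)
Lemma unif_var_perturb f g (D r : R) : 0 < r -> 0 <= D ->
  {in A, forall x, `|f x - g x| <= D} ->
  `|E (fun x => (f x - E f) ^+ 2) - E (fun x => (g x - E g) ^+ 2)| <=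
  2 * D * (r^-1 * E (fun x => (g x - E g) ^+ 2) + r) + 4 * D ^+ 2.
Proof.
move=> r0 D0 fg; have mfg := unif_mean_dist fg.
(* [f - E f = y + z] with [|z| <= 2 D], so the squares differ by [2 y z + z ^ 2]. *)
pose y x := g x - E g; pose z x := (f x - g x) - (E f - E g).
have zD x : x \in A -> `|z x| <= 2 * D.
  move=> xA; rewrite /z (le_trans (ler_normB _ _))// mulr2n mulrDl mul1r lerD//.
  exact: fg.
have key x : x \in A ->
    `|(f x - E f) ^+ 2 - y x ^+ 2| <= 2 * D * (r^-1 * y x ^+ 2 + r) + 4 * D ^+ 2.
  move=> xA; have zx := zD x xA.
  have -> : (f x - E f) ^+ 2 - y x ^+ 2 = 2 * y x * z x + z x ^+ 2.
    by rewrite /y /z; ring.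
  have yr : 2 * `|y x| <= r^-1 * y x ^+ 2 + r.
    rewrite -subr_ge0.
    have -> : r^-1 * y x ^+ 2 + r - 2 * `|y x| = r^-1 * (`|y x| - r) ^+ 2.
      by rewrite -[y x ^+ 2]real_normK ?num_real//; field; rewrite gt_eqF.
    by rewrite mulr_ge0 ?sqr_ge0// invr_ge0 ltW.
  apply: (le_trans (ler_normD _ _)); apply: lerD.
    rewrite !normrM (@ger0_norm _ 2)// mulrC ler_pM//.
  rewrite normrX (_ : 4 * D ^+ 2 = (2 * D) ^+ 2); last by ring.
  by rewrite lerXn2r ?nnegrE// mulr_ge0.
have -> : 2 * D * (r^-1 * E (fun x => y x ^+ 2) + r) + 4 * D ^+ 2 =
    E (fun x => 2 * D * (r^-1 * y x ^+ 2 + r) + 4 * D ^+ 2).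
  rewrite unif_meanD unif_mean_cst unif_meanZ unif_meanD unif_mean_cst.
  by rewrite unif_meanZ.
rewrite ler_norml; apply/andP; split.
  rewrite lerNl opprB lerBlDr -unif_meanD; apply: ler_unif_mean => x /key.
  by rewrite ler_norml => /andP[]; rewrite -/(y x); lra.
rewrite lerBlDr -unif_meanD; apply: ler_unif_mean => x /key.
by rewrite ler_norml => /andP[]; rewrite -/(y x); lra.
Qed.

End UniformMean.

(** * Limits and asymptotic equivalence from error bounds *)

Section BoundedError.
Variable R : realType.
Local Open Scope classical_set_scope.

Lemma cvg_sqrt_nat : (Num.sqrt n%:R : R) @[n --> \oo] --> +oo.
Proof.
apply/cvgryPge => M; near=> n.
apply: (le_trans (ler_norm _)); rewrite -sqrtr_sqr ler_wsqrtr//.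
by near: n; exact: nbhs_infty_ger.
Unshelve. all: by end_near. Qed.

Lemma cvg_bounded_error (a r : nat -> R) (l K : R) :
  (r n @[n --> \oo] --> +oo) ->
  (\forall n \near \oo, `|a n - l| <= K / r n) -> a n @[n --> \oo] --> l.
Proof.
move=> rpo aK; apply/cvgrPdist_le => e e0; near=> n.
have aKn : `|a n - l| <= K / r n by near: n; exact: aK.
rewrite distrC; apply: le_trans aKn _.
have r0 : 0 < r n.
  by near: n; move/cvgryPgt: rpo; exact.
rewrite ler_pdivrMr// mulrC -ler_pdivrMr//.
by near: n; move/cvgryPge: rpo; exact.
Unshelve. all: by end_near. Qed.

Lemma asymp_equiv_bounded (a b : nat -> R) (K : R) :
  (b n @[n --> \oo] --> +oo) -> (\forall n \near \oo, `|a n - b n| <= K) ->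
  asymp_equiv a b.
Proof.
move=> bpo abK; apply: (@cvg_bounded_error _ b 1 K) => //; near=> n.
have b0 : 0 < b n by near: n; move/cvgryPgt: bpo; exact.
have -> : a n / b n - 1 = (a n - b n) / b n by field; rewrite gt_eqF.
rewrite normrM [X in _ * X]ger0_norm ?invr_ge0 ?(ltW b0)//.
rewrite ler_wpM2r ?invr_ge0 ?(ltW b0)//.
by near: n; exact: abK.
Unshelve. all: by end_near. Qed.

End BoundedError.

(** * Longest alternating subsequences and descents *)

Section AlternatingWords.
Local Open Scope nat_scope.
Implicit Types (d : bool) (x y z : nat) (v w : seq nat) (l : seq bool).

(** [a] is the letter preceding [l]; with [a = false] a virtual ascent precedes the word. *)
Fixpoint changes (a : bool) l : nat :=
  if l is b :: l' then (a != b) + changes b l' else 0.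

Definition descents x w : seq bool := pairmap (fun y z => z < y) x w.

(** A recursive form of [alternating]; [d] is the direction demanded of the next step, [true] for a
    descent. *)
Fixpoint alt d x v : bool :=
  if v is y :: v' then (if d then y < x else x < y) && alt (~~ d) y v' else true.

Lemma changes_rcons a l b : changes a (rcons l b) = changes a l + (last a l != b).
Proof. by elim: l a => [|c l IH] a //=; rewrite ?addn0// IH addnA. Qed.

Lemma changes_le a b l : changes a l <= (a != b) + changes b l.
Proof. by case: l => [|c l]/=; [|case: a b c => -[] []; lia]. Qed.

Lemma alternating_cons x v : Defs.alternating (x :: v) = alt true x v.
Proof.
rewrite /Defs.alternating /=.
have altE d : all (fun j => if odd j (+) ~~ d
      then nth 0 (x :: v) j < nth 0 (x :: v) j.+1
      else nth 0 (x :: v) j.+1 < nth 0 (x :: v) j) (iota 0 (size v)) = alt d x v.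
  elim: v x d => [|y v IH] x d //=; rewrite -IH (iotaDl 1 0) all_map.
  congr (_ && _); first by case: d.
  by apply: eq_all => j /=; rewrite negbK; case: (odd j) d => -[].
by rewrite -altE; apply: eq_all => j; rewrite addbF.
Qed.

(* A subsequence that starts at [x] although the next letter [y] continues in the
   wrong direction may start at [y] instead. *)
Lemma alt_subseq_le d x w z v : subseq (z :: v) (x :: w) -> alt d z v ->
  size v <= changes (~~ d) (descents x w).
Proof.
elim: w x z v d => [|y w IH] x z v d.
  by move=> /size_subseq /=; case: v.
rewrite [subseq _ _]/=; case: eqVneq => [->|_] sv; last first.
  move=> /(IH _ _ _ _ sv) /leq_trans; apply; exact: changes_le.
case: v sv => [//|u v] sv.
rewrite [alt _ _ _]/= => /andP[xu av].
have [e|e] := eqVneq (y < x) d.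
  by have /= := IH _ _ _ _ sv av; rewrite negbK e; case: (d).
have uy : u != y by move: xu e; case: (d); case: ltnP; lia.
have sv' : subseq (y :: u :: v) (y :: w).
  by move: sv; rewrite /= (negPf uy) eqxx.
have /(IH _ _ _ _ sv') /= : alt d y (u :: v).
  by rewrite /= av andbT; move: xu e; case: (d); case: ltnP; lia.
by move/leq_trans; apply; move: e; case: (d); case: ltnP.
Qed.

Lemma alt_subseq_ex d x w : uniq (x :: w) -> exists z v,
  [/\ subseq (z :: v) (x :: w), alt d z v,
      size v = changes (~~ d) (descents x w) & if d then x <= z else z <= x].
Proof.
elim: w x d => [|y w IH] x d.
  by move=> _; exists x, [::]; rewrite /= eqxx; case: d.
rewrite cons_uniq inE negb_or => /andP[/andP[xy xw] uw].
have [e|e] := eqVneq (y < x) d.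
  have [z [v [sv av ev zy]]] := IH y (~~ d) uw.
  exists x, (z :: v); split.
  - by rewrite /= eqxx.
  - rewrite /= av andbT; move: zy e xy; case: (d); case: ltnP => //=; lia.
  - by rewrite /= ev negbK e; case: (d).
  - by case: (d).
have [z [v [sv av ev zy]]] := IH y d uw.
have e' : (y < x) = ~~ d by move: e; case: (d); case: ltnP.
exists z, v; split => //.
- by apply: (subseq_trans sv); exact: subseq_cons.
- by rewrite /= ev e' eqxx.
- by move: zy e'; case: (d); case: ltnP => //=; lia.
Qed.

End AlternatingWords.

(** * Descent words of permutations and insertion of a letter *)

Section PermWords.
Local Open Scope nat_scope.
Implicit Types n : nat.

Definition word n (s : 'S_n) : seq nat := [seq val (s i) | i <- enum 'I_n].

Definition pdesc n (s : 'S_n.+1) : seq bool :=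
  descents (s ord0) (behead (word s)).

Lemma wordE n (s : 'S_n.+1) : word s = val (s ord0) :: behead (word s).
Proof. by rewrite /word enum_ordSl. Qed.

Lemma word_uniq n (s : 'S_n) : uniq (word s).
Proof. by rewrite map_inj_uniq ?enum_uniq// => i j /val_inj /perm_inj. Qed.

(** An alternating word starts with a descent, hence the virtual ascent [false] in front; the
    successor counts the starting letter. *)
Lemma LAS_pdesc n (s : 'S_n.+1) : LAS s = (changes false (pdesc s)).+1.
Proof.
apply/eqP; rewrite eqn_leq; apply/andP; split.
  apply/bigmax_leqP => A; rewrite cardE.
  have sA : subseq [seq val (s i) | i <- enum A] (word s).
    by apply: map_subseq; rewrite enumT; exact: filter_subseq.
  move: sA; case: (enum A) => [//|i l]; rewrite [map _ _]/= alternating_cons.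
  by rewrite wordE /= ltnS -(size_map (fun i => val (s i))) => /alt_subseq_le h /h.
have [|z [v [sv av ev _]]] := @alt_subseq_ex true (s ord0) (behead (word s)).
  by rewrite -wordE word_uniq.
rewrite -wordE in sv; have /subseqP[m sm] := sv.
rewrite /word -map_mask => zvE.
(* The mask selecting the subsequence becomes a set of positions; it enumerates back to the mask
   since [enum] is duplicate-free. *)
pose A : {set 'I_n.+1} := [set i in mask m (enum 'I_n.+1)].
have AE : enum A = mask m (enum 'I_n.+1).
  have /(subseq_uniqP (enum_uniq 'I_n.+1)) -> := mask_subseq m (enum 'I_n.+1).
  apply: (@etrans _ _ [seq i <- enum 'I_n.+1 | i \in A]); first by rewrite enumT.
  by apply: eq_filter => i; rewrite inE.
have -> : (changes false (pdesc s)).+1 = #|A|.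
  by rewrite cardE AE -ev -(size_map (fun i => val (s i))) -zvE.
apply: leq_bigmax_cond; rewrite AE -zvE alternating_cons//.
Qed.

Lemma LAS_gt3 n (s : 'S_n) : 3 < LAS s -> exists i j k l : 'I_n,
  [/\ i < j, j < k, k < l, s j < s i & s j < s k /\ s l < s k].
Proof.
apply: contraPP => no; apply/negP; rewrite -leqNgt; apply/bigmax_leqP => A altA.
rewrite leqNgt; apply/negP => A3; apply: no.
have so : sorted ltn [seq val i | i <- enum A].
  apply: (subseq_sorted ltn_trans (s2 := [seq val i | i <- enum 'I_n])).
    by apply: map_subseq; rewrite enumT; exact: filter_subseq.
  by rewrite val_enum_ord iota_ltn_sorted.
move: altA so A3; rewrite cardE.
case: (enum A) => [|i [|j [|k [|l u]]]]//.
rewrite [map _ _]/= alternating_cons /= => /and4P[a b c _] /and4P[a' b' c' _] _.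
by exists i, j, k, l; split.
Qed.

(** [s'] is [s] with the letter at position [i] deleted and the others standardised. *)
Lemma lift_perm_surj n (i : 'I_n.+1) (s : 'S_n.+1) :
  exists s', s = lift_perm i (s i) s'.
Proof.
have ne k : s i != s (lift i k) by rewrite (inj_eq perm_inj) neq_lift.
pose t k := s2val (unlift_some (ne k)).
have tE k : s (lift i k) = lift (s i) (t k) := s2valP (unlift_some (ne k)).
have t_inj : injective t.
  by move=> k l e; apply: (@lift_inj _ i); apply: (@perm_inj _ s); rewrite !tE e.
exists (perm t_inj); apply/permP => k.
by case: (unliftP i k) => [k'|] ->; rewrite ?lift_perm_id// lift_perm_lift permE.
Qed.

Lemma lift_perm_inj n (i j j' : 'I_n.+1) (s s' : 'S_n) :
  lift_perm i j s = lift_perm i j' s' -> j = j' /\ s = s'.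
Proof.
move=> e; have ej : j = j' by rewrite -(lift_perm_id i j s) e lift_perm_id.
split=> //; apply/permP => k; apply: (@lift_inj _ j).
by rewrite -(lift_perm_lift i j s) e lift_perm_lift ej.
Qed.

Lemma lift_ltn n (h : 'I_n.+1) (i j : 'I_n) : (lift h i < lift h j) = (i < j).
Proof. by rewrite /= ltnNge leq_bump2 -ltnNge. Qed.

Lemma descents_bump h x w :
  descents (bump h x) [seq bump h i | i <- w] = descents x w.
Proof.
by elim: w x => //= y w IH x; rewrite -/(descents _ _) IH ltnNge leq_bump2 -ltnNge.
Qed.

Lemma word_lift0 n (j : 'I_n.+1) (s : 'S_n) :
  word (lift_perm ord0 j s) = val j :: [seq bump j i | i <- word s].
Proof.
rewrite /word enum_ordSl /= lift_perm_id; congr (_ :: _).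
rewrite -!map_comp; apply: eq_map => i /=.
by rewrite lift_perm_lift.
Qed.

Lemma word_lift_max n (j : 'I_n.+1) (s : 'S_n) :
  word (lift_perm ord_max j s) = rcons [seq bump j i | i <- word s] j.
Proof.
rewrite /word enum_ordSr map_rcons lift_perm_id; congr rcons.
rewrite -!map_comp; apply: eq_map => i /=.
have -> : widen_ord (leqnSn n) i = lift ord_max i.
  by apply: val_inj; rewrite /= /bump leqNgt ltn_ord.
by rewrite lift_perm_lift.
Qed.

Lemma pdesc_lift0 n (j : 'I_n.+2) (s : 'S_n.+1) :
  pdesc (lift_perm ord0 j s) = (s ord0 < j) :: pdesc s.
Proof.
rewrite /pdesc word_lift0 lift_perm_id /= wordE /= -/(descents _ _).
rewrite descents_bump; congr (_ :: _).
by rewrite /bump; case: leqP => /=; lia.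
Qed.

Lemma last_word n (s : 'S_n.+1) : last (s ord0 : nat) (behead (word s)) = s ord_max.
Proof.
have -> : last (s ord0 : nat) (behead (word s)) = last 0 (word s) by rewrite wordE.
by rewrite /word enum_ordSr map_rcons last_rcons.
Qed.

Lemma pdesc_lift_max n (j : 'I_n.+2) (s : 'S_n.+1) :
  pdesc (lift_perm ord_max j s) = rcons (pdesc s) (j <= s ord_max).
Proof.
have e : word (lift_perm ord_max j s) =
    bump j (s ord0) :: rcons [seq bump j i | i <- behead (word s)] j.
  by rewrite word_lift_max {1}wordE.
have := wordE (lift_perm ord_max j s); rewrite /pdesc e /= => -[<-].
rewrite -cats1 /descents pairmap_cat -!/(descents _ _) descents_bump /= cats1.
congr rcons; rewrite last_map last_word.
by rewrite /bump; case: leqP => /=; lia.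
Qed.

End PermWords.

(** * Pattern classes growing by one letter *)

Lemma perm_ltnN n (s : 'S_n) (i j : 'I_n) :
  (i < j)%N -> (s j < s i)%N = ~~ (s i < s j)%N.
Proof.
move=> ij; have : (s i : nat) != s j.
  by apply: contraTneq ij => /val_inj /perm_inj ->; rewrite ltnn.
lia.
Qed.

Section Patterns.
Local Open Scope nat_scope.
Variable n : nat.
Implicit Types (s : 'S_n) (i j k : 'I_n).

Lemma containsP s (p : 'S_3) : reflect
  (exists i j k, [/\ i < j, j < k, (s i < s j) = (p v1 < p v2),
     (s i < s k) = (p v1 < p v3) & (s j < s k) = (p v2 < p v3)])
  (contains s p).
Proof.
apply: (iffP existsP) => [[f /andP[/forallP fm /forallP fp]]|].
  exists (f v1), (f v2), (f v3).
  have mono (a b : 'I_3) : a < b -> f a < f b by move: (fm a) => /forallP/(_ b)/implyP.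
  have patt (a b : 'I_3) : (s (f a) < s (f b)) = (p a < p b).
    by move: (fp a) => /forallP/(_ b)/eqP.
  by split; rewrite ?patt// mono.
move=> [i [j [k [ij jk h12 h13 h23]]]].
have ik := ltn_trans ij jk.
pose f := [ffun a : 'I_3 => if a == v1 then i else if a == v2 then j else k].
have f1 : f v1 = i by rewrite ffunE eqxx.
have f2 : f v2 = j by rewrite ffunE.
have f3 : f v3 = k by rewrite ffunE.
have cases (a : 'I_3) : [\/ a = v1, a = v2 | a = v3].
  case: a => [[|[|[|//]]] la]; [constructor 1|constructor 2|constructor 3];
  exact: val_inj.
exists f; apply/andP; split; apply/forallP => a; apply/forallP => b.
  by case: (cases a) => ->; case: (cases b) => ->; rewrite ?f1 ?f2 ?f3 ?ij ?jk ?ik.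
wlog ab : a b / a < b.
  move=> wl; have [ab|ba|/val_inj ->] := ltngtP a b; first exact: wl.
    have fba : f b < f a.
      by move: ba; case: (cases a) => ->; case: (cases b) => ->; rewrite ?f1 ?f2 ?f3.
    by rewrite (perm_ltnN p ba) (perm_ltnN s fba) (eqP (wl _ _ ba)) eqxx.
  by rewrite !ltnn.
by move: ab; case: (cases a) => ->; case: (cases b) => -> //= _;
  rewrite ?f1 ?f2 ?f3 ?h12 ?h13 ?h23 eqxx.
Qed.

Lemma contains132P s : reflect
  (exists i j k, [/\ i < j, j < k & s i < s k < s j]) (contains s p132).
Proof.
apply: (iffP (containsP s _)); rewrite /p132 /oneline !permE /=.
  move=> [i [j [k [ij jk a b c]]]]; exists i, j, k; split=> //.
  have := perm_ltnN s ij; have := perm_ltnN s jk.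
  have := perm_ltnN s (ltn_trans ij jk); lia.
by move=> [i [j [k [ij jk a]]]]; exists i, j, k; split; lia.
Qed.

Lemma contains123P s : reflect
  (exists i j k, [/\ i < j, j < k & s i < s j < s k]) (contains s p123).
Proof.
apply: (iffP (containsP s _)); rewrite /p123 /oneline !permE /=.
  move=> [i [j [k [ij jk a b c]]]]; exists i, j, k; split=> //.
  have := perm_ltnN s ij; have := perm_ltnN s jk.
  have := perm_ltnN s (ltn_trans ij jk); lia.
by move=> [i [j [k [ij jk a]]]]; exists i, j, k; split; lia.
Qed.

Lemma contains213P s : reflect
  (exists i j k, [/\ i < j, j < k & s j < s i < s k]) (contains s p213).
Proof.
apply: (iffP (containsP s _)); rewrite /p213 /oneline !permE /=.
  move=> [i [j [k [ij jk a b c]]]]; exists i, j, k; split=> //.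
  have := perm_ltnN s ij; have := perm_ltnN s jk.
  have := perm_ltnN s (ltn_trans ij jk); lia.
by move=> [i [j [k [ij jk a]]]]; exists i, j, k; split; lia.
Qed.

Lemma contains231P s : reflect
  (exists i j k, [/\ i < j, j < k & s k < s i < s j]) (contains s p231).
Proof.
apply: (iffP (containsP s _)); rewrite /p231 /oneline !permE /=.
  move=> [i [j [k [ij jk a b c]]]]; exists i, j, k; split=> //.
  have := perm_ltnN s ij; have := perm_ltnN s jk.
  have := perm_ltnN s (ltn_trans ij jk); lia.
by move=> [i [j [k [ij jk a]]]]; exists i, j, k; split; lia.
Qed.

Lemma contains312P s : reflect
  (exists i j k, [/\ i < j, j < k & s j < s k < s i]) (contains s p312).
Proof.
apply: (iffP (containsP s _)); rewrite /p312 /oneline !permE /=.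
  move=> [i [j [k [ij jk a b c]]]]; exists i, j, k; split=> //.
  have := perm_ltnN s ij; have := perm_ltnN s jk.
  have := perm_ltnN s (ltn_trans ij jk); lia.
by move=> [i [j [k [ij jk a]]]]; exists i, j, k; split; lia.
Qed.

Lemma contains321P s : reflect
  (exists i j k, [/\ i < j, j < k & s k < s j < s i]) (contains s p321).
Proof.
apply: (iffP (containsP s _)); rewrite /p321 /oneline !permE /=.
  move=> [i [j [k [ij jk a b c]]]]; exists i, j, k; split=> //.
  have := perm_ltnN s ij; have := perm_ltnN s jk.
  have := perm_ltnN s (ltn_trans ij jk); lia.
by move=> [i [j [k [ij jk a]]]]; exists i, j, k; split; lia.
Qed.

Lemma in_Av2P s (p q : 'S_3) (P Q : 'I_n -> 'I_n -> 'I_n -> bool) :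
  reflect (exists i j k, [/\ i < j, j < k & P i j k]) (contains s p) ->
  reflect (exists i j k, [/\ i < j, j < k & Q i j k]) (contains s q) ->
  s \in Av [set p; q]%SET n <->
  forall i j k, i < j -> j < k -> ~~ P i j k /\ ~~ Q i j k.
Proof.
move=> rP rQ; rewrite inE; split=> [/forall_inP h i j k ij jk|h].
  split; apply/negP => a.
    by move/negP: (h p (set21 p q)); apply; apply/rP; exists i, j, k.
  by move/negP: (h q (set22 p q)); apply; apply/rQ; exists i, j, k.
apply/forall_inP => r; rewrite !inE => /orP[]/eqP ->.
  by apply/rP => -[i [j [k [ij jk a]]]]; have [] := h i j k ij jk; rewrite a.
by apply/rQ => -[i [j [k [ij jk a]]]]; have [] := h i j k ij jk; rewrite a.
Qed.

Lemma Av_132_321P s : s \in Av [set p132; p321]%SET n <->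
  forall i j k, i < j -> j < k ->
    ~~ (s i < s k < s j) /\ ~~ (s k < s j < s i).
Proof. exact: in_Av2P (contains132P s) (contains321P s). Qed.

Lemma Av_132_231P s : s \in Av [set p132; p231]%SET n <->
  forall i j k, i < j -> j < k ->
    ~~ (s i < s k < s j) /\ ~~ (s k < s i < s j).
Proof. exact: in_Av2P (contains132P s) (contains231P s). Qed.

Lemma Av_132_312P s : s \in Av [set p132; p312]%SET n <->
  forall i j k, i < j -> j < k ->
    ~~ (s i < s k < s j) /\ ~~ (s j < s k < s i).
Proof. exact: in_Av2P (contains132P s) (contains312P s). Qed.

Lemma Av_132_123P s : s \in Av [set p132; p123]%SET n <->
  forall i j k, i < j -> j < k ->
    ~~ (s i < s k < s j) /\ ~~ (s i < s j < s k).
Proof. exact: in_Av2P (contains132P s) (contains123P s). Qed.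

Lemma Av_132_213P s : s \in Av [set p132; p213]%SET n <->
  forall i j k, i < j -> j < k ->
    ~~ (s i < s k < s j) /\ ~~ (s j < s i < s k).
Proof. exact: in_Av2P (contains132P s) (contains213P s). Qed.

(** In [w0 > w1 < w2 > w3], avoiding 132 at [w1 w2 w3] forces [w3 < w1], and then [w0 w1 w3] is a
    321. *)
Lemma LAS_132_321 s : s \in Av [set p132; p321]%SET n -> LAS s <= 3.
Proof.
move=> /Av_132_321P h; rewrite leqNgt; apply/negP.
move=> /LAS_gt3 [i [j [k [l [ij jk kl a [b c]]]]]].
have [h1 _] := h j k l jk kl.
have jl := ltn_trans jk kl.
have [_ h2] := h i j l ij jl.
have := perm_ltnN s jl; lia.
Qed.

(** The peak [w1 < w2 > w3] is by itself a 132 or a 231. *)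
Lemma LAS_132_231 s : s \in Av [set p132; p231]%SET n -> LAS s <= 3.
Proof.
move=> /Av_132_231P h; rewrite leqNgt; apply/negP.
move=> /LAS_gt3 [i [j [k [l [ij jk kl a [b c]]]]]].
have [h1 h2] := h j k l jk kl.
have := perm_ltnN s (ltn_trans jk kl); lia.
Qed.

End Patterns.

(** * Binomial statistics on binary generating trees *)

Section BinaryGrowth.
Variables (R : comRingType) (A : forall n, {set 'S_n.+1}).
Variables (ext : forall n, bool -> 'S_n.+1 -> 'S_n.+2).
Variables (stat : forall n, 'S_n.+1 -> nat).
Hypothesis A0 : A 0 = [set 1%g]%SET.
Hypothesis ext_mem : forall n b s, s \in A n -> ext b s \in A n.+1.
Hypothesis ext_surj : forall n s, s \in A n.+1 ->
  exists b s', s' \in A n /\ s = ext b s'.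
Hypothesis ext_inj : forall n b b' (s s' : 'S_n.+1),
  ext b s = ext b' s' -> b = b' /\ s = s'.
Hypothesis stat_ext : forall n b s, s \in A n ->
  stat (ext b s) = (stat s + b)%N.

(** Each permutation has two children, on which [stat] grows by 0 and by 1, so Pascal's rule
    applies. An arbitrary [F] yields the cardinality, the moments and the distribution function at
    once. *)
Lemma sum_stat n (F : nat -> R) :
  \sum_(s in A n) F (stat s) =
  \sum_(k < n.+1) 'C(n, k)%:R * F (stat (1%g : 'S_1) + k)%N.
Proof.
elim: n F => [|n IH] F.
  by rewrite A0 big_set1 big_ord1 addn0 mul1r.
have -> : A n.+1 = [set ext p.1 p.2 | p : bool * 'S_n.+1 in [set p | p.2 \in A n]]%SET.
  apply/setP => s; apply/idP/imsetP => [/ext_surj[b [s' [s'A ->]]]|[[b s']]].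
    by exists (b, s') => //; rewrite !inE.
  by rewrite !inE /= => s'A ->; exact: ext_mem.
rewrite big_imset/=; last by move=> [b s] [b' s'] _ _ /= /ext_inj[-> ->].
rewrite (eq_bigl (fun p => xpredT p.1 && (p.2 \in A n))) => [|p]; last by rewrite inE.
rewrite -(pair_big xpredT (fun s => s \in A n) (fun b s => F (stat (ext b s))))/=.
rewrite big_bool/=.
rewrite (eq_bigr (fun s => F (stat s + 1)%N)) => [|s sA]; last by rewrite stat_ext.
rewrite [X in _ + X](eq_bigr (fun s => F (stat s))) => [|s sA]; last first.
  by rewrite stat_ext// addn0.
rewrite (IH (fun k => F (k + 1)%N)) IH.
set c := stat 1%g.
rewrite [RHS]big_ord_recl /= bin0 mul1r addn0.
under [in RHS]eq_bigr do rewrite binS natrD mulrDl.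
rewrite big_split/= addrA [RHS]addrC; congr (_ + _).
  by apply: eq_bigr => k _; rewrite /bump/= add1n addn1 addnS.
rewrite big_ord_recl /= bin0 mul1r addn0; congr (_ + _).
rewrite [RHS]big_ord_recr /= bin_small// mul0r addr0.
by apply: eq_bigr => k _.
Qed.

End BinaryGrowth.

Section LiftGrowth.
Variables (R : comRingType) (A : forall n, {set 'S_n.+1}).
Variables (i0 : forall n, 'I_n.+2) (j1 j0 : forall n, 'S_n.+1 -> 'I_n.+2).
Variables (h : forall n, 'S_n.+1 -> bool) (stat : forall n, 'S_n.+1 -> nat).
Hypothesis A0 : A 0 = [set 1%g]%SET.
Hypothesis j10 : forall n (s : 'S_n.+1), j1 s != j0 s.
Hypothesis A_lift : forall n j (s : 'S_n.+1),
  lift_perm (i0 n) j s \in A n.+1 <-> s \in A n /\ (j = j1 s \/ j = j0 s).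
Hypothesis stat_lift : forall n (s : 'S_n.+1) (d : bool), s \in A n ->
  stat (lift_perm (i0 n) (if d then j1 s else j0 s) s) = (stat s + (d != h s))%N.

(** Which inserted value raises [stat] depends on [s] through [h s]; relabelling the children by
    [b (+) h s] makes the label equal to the increment. *)
Lemma sum_stat_lift n (F : nat -> R) :
  \sum_(s in A n) F (stat s) =
  \sum_(k < n.+1) 'C(n, k)%:R * F (stat (1%g : 'S_1) + k)%N.
Proof.
pose ext n b (s : 'S_n.+1) :=
  lift_perm (i0 n) (if b (+) h s then j1 s else j0 s) s.
apply: (@sum_stat R A ext stat) => {n F}.
- exact: A0.
- by move=> n b s sA; apply/A_lift; split=> //; case: ifP; [left|right].
- move=> n s; have [s' sE] := lift_perm_surj (i0 n) s.
  rewrite {1}sE => /A_lift[s'A js]; exists ((s (i0 n) == j1 s') (+) h s'), s'.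
  split=> //; rewrite /ext {1}sE -addbA addbb addbF; congr lift_perm.
  by case: eqVneq => // ne; case: js => // /eqP; rewrite (negPf ne).
- move=> n b b' s s' /lift_perm_inj[+ ss]; rewrite -{}ss => e; split=> //.
  move: e (j10 s).
  by case: b; case: b'; case: (h s) => //= ->; rewrite eqxx.
- move=> n b s sA; rewrite /ext stat_lift//.
  by case: b (h s) => -[].
Qed.

End LiftGrowth.

(** * Insertion rules and binomial statistics of the three growing classes *)

Section Classes.
Local Open Scope nat_scope.
Implicit Types n : nat.

Lemma Av1 (T : {set 'S_3}) : Av T 1 = [set 1%g]%SET.
Proof.
apply/setP => s; rewrite !inE.
have -> : s = 1%g by apply/permP => i; rewrite !ord1.
rewrite eqxx; apply/forall_inP => p _; apply/containsP => -[i [j [k []]]].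
by rewrite !ord1.
Qed.

Lemma neq_max_lt n (i : 'I_n.+1) : i != ord_max -> i < (ord_max : 'I_n.+1).
Proof. by rewrite -val_eqE /=; have := ltn_ord i; lia. Qed.

Lemma neq0_gt0 n (i : 'I_n.+1) : i != ord0 -> (ord0 : 'I_n.+1) < i.
Proof. by rewrite -val_eqE /= lt0n. Qed.

Lemma perm_neq n (s : 'S_n) (i j : 'I_n) : s i != s j -> i != j.
Proof. by apply: contraNneq => ->. Qed.

(** In both patterns the last letter is the middle one. A last letter that is not extreme completes
    one of them with the minimum and the maximum; an extreme one never does. *)
Lemma Av_lift_132_312 n (j : 'I_n.+2) (s : 'S_n.+1) :
  lift_perm ord_max j s \in Av [set p132; p312]%SET n.+2 <->
  s \in Av [set p132; p312]%SET n.+1 /\ (j = ord0 \/ j = ord_max).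
Proof.
rewrite !Av_132_312P; set t := lift_perm _ _ _; split=> [h|[h hj] a b c].
  split=> [a b c ab bc|].
    have := h (lift ord_max a) (lift ord_max b) (lift ord_max c).
    by rewrite !lift_ltn !lift_perm_lift !lift_ltn => /(_ ab bc).
  have [->|j0] := eqVneq j ord0; first by left.
  have [->|jm] := eqVneq j ord_max; first by right.
  have tm : t ord_max = j by rewrite lift_perm_id.
  pose a := (t^-1)%g ord0; pose b := (t^-1)%g ord_max.
  have ta : t a = ord0 by rewrite permKV.
  have tb : t b = ord_max by rewrite permKV.
  have am : a < (ord_max : 'I_n.+2).
    by apply: neq_max_lt; apply: (@perm_neq _ t); rewrite ta tm eq_sym.
  have bm : b < (ord_max : 'I_n.+2).
    by apply: neq_max_lt; apply: (@perm_neq _ t); rewrite tb tm eq_sym.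
  have j0' := neq0_gt0 j0; have jm' := neq_max_lt jm.
  have [ab|ba|/val_inj ab] := ltngtP a b.
  - by have [] := h a b ord_max ab bm; rewrite ta tb tm j0' jm'.
  - by have [_] := h b a ord_max ba am; rewrite ta tb tm j0' jm'.
  - by move: ta; rewrite ab tb.
case: (unliftP ord_max a) => [a'|] ->; last by move=> /= ab; have := ltn_ord b; lia.
case: (unliftP ord_max b) => [b'|] -> ab; last by move=> /= bc; have := ltn_ord c; lia.
rewrite lift_ltn in ab.
case: (unliftP ord_max c) => [c'|] ->; rewrite ?lift_ltn => bc.
  by rewrite !lift_perm_lift !lift_ltn; exact: h.
rewrite !lift_perm_lift lift_perm_id.
case: hj => ->; move: (@lift n.+2 _ (s a')) (@lift n.+2 _ (s b')) => u v;
  have := ltn_ord u; have := ltn_ord v; rewrite /=; lia.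
Qed.

(** In both patterns the first letter is the smallest. A first letter below [n] precedes the two
    largest values [n] and [n.+1]; otherwise at most one value exceeds it. *)
Lemma Av_lift_132_123 n (j : 'I_n.+2) (s : 'S_n.+1) :
  lift_perm ord0 j s \in Av [set p132; p123]%SET n.+2 <->
  s \in Av [set p132; p123]%SET n.+1 /\ (j = inord n \/ j = ord_max).
Proof.
have v_in : (inord n : 'I_n.+2) = n :> nat by rewrite inordK.
rewrite !Av_132_123P; set t := lift_perm _ _ _; split=> [h|[h hj] a b c].
  split=> [a b c ab bc|].
    have := h (lift ord0 a) (lift ord0 b) (lift ord0 c).
    by rewrite !lift_ltn !lift_perm_lift !lift_ltn => /(_ ab bc).
  have [->|j0] := eqVneq j (inord n); first by left.
  have [->|jm] := eqVneq j ord_max; first by right.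
  have tm : t ord0 = j by rewrite lift_perm_id.
  pose a := (t^-1)%g (inord n); pose b := (t^-1)%g ord_max.
  have ta : t a = inord n by rewrite permKV.
  have tb : t b = ord_max by rewrite permKV.
  have am : (ord0 : 'I_n.+2) < a.
    by apply: neq0_gt0; apply: (@perm_neq _ t); rewrite ta tm eq_sym.
  have bm : (ord0 : 'I_n.+2) < b.
    by apply: neq0_gt0; apply: (@perm_neq _ t); rewrite tb tm eq_sym.
  have jn : j < n.
    by move: j0 jm; rewrite -!val_eqE /= v_in; have := ltn_ord j; lia.
  have [ab|ba|/val_inj ab] := ltngtP a b.
  - by have [_] := h ord0 a b am ab; rewrite ta tb tm v_in jn /= ltnSn.
  - by have [] := h ord0 b a bm ba; rewrite ta tb tm v_in jn /= ltnSn.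
  - by move: (congr1 val ta); rewrite ab tb /= v_in; lia.
case: (unliftP ord0 b) => [b'|] ->; last by rewrite ltn0.
case: (unliftP ord0 c) => [c'|] ->; last by rewrite ltn0.
case: (unliftP ord0 a) => [a'|] ->; rewrite ?lift_ltn => ab bc.
  by rewrite !lift_perm_lift !lift_ltn; exact: h.
have jn : n <= j by case: hj => ->; rewrite /= ?v_in.
rewrite !lift_perm_lift lift_perm_id.
move: (@lift n.+2 _ (s b')) (@lift n.+2 _ (s c')) => u v.
by have := ltn_ord u; have := ltn_ord v; lia.
Qed.

(** If [j] is not the maximum and the second letter is not [j.+1], then [j], the second letter and
    [j.+1] form a 132 or a 213. Conversely, if the first two letters are consecutive values, no
    value separates them, and a pattern starting at the first one also starts at the second. *)
Lemma Av_lift_132_213 n (j : 'I_n.+2) (s : 'S_n.+1) :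
  lift_perm ord0 j s \in Av [set p132; p213]%SET n.+2 <->
  s \in Av [set p132; p213]%SET n.+1 /\ (j = ord_max \/ j = inord (s ord0)).
Proof.
have v_in : (inord (s ord0) : 'I_n.+2) = s ord0 :> nat.
  by rewrite inordK// ltnS ltnW.
rewrite !Av_132_213P; set t := lift_perm _ _ _; split=> [h|[h hj] a b c].
  split=> [a b c ab bc|].
    have := h (lift ord0 a) (lift ord0 b) (lift ord0 c).
    by rewrite !lift_ltn !lift_perm_lift !lift_ltn => /(_ ab bc).
  have [->|jm] := eqVneq j ord_max; first by left.
  right; apply: val_inj; rewrite /= v_in.
  have jn : j < n.+1 by exact: neq_max_lt jm.
  pose a := (t^-1)%g (inord j.+1).
  have ta : t a = j.+1 :> nat by rewrite permKV inordK.
  have t0 : t ord0 = j by rewrite lift_perm_id.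
  have t1 : t (lift ord0 ord0) = bump j (s ord0) :> nat by rewrite lift_perm_lift.
  have a0 : a != ord0.
    by apply/eqP => a0; move: ta; rewrite a0 t0; lia.
  have [a1|a1] := eqVneq a (lift ord0 ord0).
    by move: ta; rewrite a1 t1 /bump; case: leqP => /=; lia.
  have lt1a : lift ord0 (ord0 : 'I_n.+1) < a.
    by move: a0 a1; rewrite -!val_eqE /= /bump /=; lia.
  have [] := h ord0 (lift ord0 ord0) a isT lt1a.
  rewrite ta t0 t1 ltnSn andbT.
  have : bump j (s ord0) != j.+1.
    by rewrite -t1 -ta; apply: contra a1 => /eqP/val_inj/perm_inj ->.
  by rewrite /bump; case: leqP => /=; lia.
case: (unliftP ord0 b) => [b'|] ->; last by rewrite ltn0.
case: (unliftP ord0 c) => [c'|] ->; last by rewrite ltn0.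
case: (unliftP ord0 a) => [a'|] ->; rewrite ?lift_ltn => ab bc.
  by rewrite !lift_perm_lift !lift_ltn; exact: h.
rewrite !lift_perm_lift lift_perm_id.
case: hj => ->.
  move: (@lift n.+2 _ (s b')) (@lift n.+2 _ (s c')) => u v.
  by have := ltn_ord u; have := ltn_ord v; rewrite /=; lia.
have c0 : (ord0 : 'I_n.+1) < c' by apply: leq_ltn_trans bc.
have sc0 := perm_ltnN s c0.
rewrite /= v_in /bump.
have [b0|b0] := eqVneq b' ord0.
  by rewrite b0 leqnn; split; case: (leqP (s ord0) (s c')) => /=; lia.
have := h ord0 b' c' (neq0_gt0 b0) bc.
have sb0 := perm_ltnN s (neq0_gt0 b0).
by case: (leqP (s ord0) (s c')); case: (leqP (s ord0) (s b')) => /=; lia.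
Qed.

Definition stat_132_312 n (s : 'S_n.+1) : nat := changes false (pdesc s).

Lemma sum_132_312 (R : comRingType) n (F : nat -> R) :
  (\sum_(s in Av [set p132; p312]%SET n.+1) F (stat_132_312 s) =
   \sum_(k < n.+1) 'C(n, k)%:R * F (stat_132_312 (1%g : 'S_1) + k)%N)%R.
Proof.
apply: (@sum_stat_lift R (fun n => Av [set p132; p312]%SET n.+1)
  (fun n => ord_max) (fun n _ => ord0) (fun n _ => ord_max)
  (fun n s => last false (pdesc s))).
- exact: Av1.
- by [].
- by move=> m j s; exact: Av_lift_132_312.
- move=> m s d _; rewrite /stat_132_312 pdesc_lift_max changes_rcons eq_sym.
  congr (_ + nat_of_bool (_ != _)).
  by case: d => //=; have := ltn_ord (s ord_max); lia.
Qed.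

Lemma LAS_132_312 n (s : 'S_n.+1) : LAS s = (stat_132_312 s).+1.
Proof. exact: LAS_pdesc. Qed.

(* The first value is one of the two largest; the bits "the value is not the
   maximum of its suffix" are independent, ascents are their descents [10], and
   [stat_132_123] counts the changes of this bit word, up to the constant 1. *)
Definition stat_132_123 n (s : 'S_n.+1) : nat :=
  changes true (rcons (pdesc s) true) + (s ord0 == ord_max).

Lemma pdesc_max n (s : 'S_n.+1) : s ord0 = ord_max -> head true (pdesc s).
Proof.
case: n s => [|n] s s0; rewrite /pdesc /word enum_ordSl /=.
  by rewrite (size0nil (size_enum_ord 0)).
rewrite enum_ordSl /= s0 /=.
have := ltn_ord (s (lift ord0 ord0)).
have : s (lift ord0 ord0) != ord_max by rewrite -s0 (inj_eq perm_inj).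
by rewrite -val_eqE /=; lia.
Qed.

Lemma changes_head l : head true l ->
  changes false (rcons l true) = (changes true (rcons l true)).+1.
Proof. by case: l => [|[] l]. Qed.

Lemma sum_132_123 (R : comRingType) n (F : nat -> R) :
  (\sum_(s in Av [set p132; p123]%SET n.+1) F (stat_132_123 s) =
   \sum_(k < n.+1) 'C(n, k)%:R * F (stat_132_123 (1%g : 'S_1) + k)%N)%R.
Proof.
apply: (@sum_stat_lift R (fun n => Av [set p132; p123]%SET n.+1)
  (fun n => ord0) (fun n _ => inord n) (fun n _ => ord_max)
  (fun n s => s ord0 != ord_max)).
- exact: Av1.
- by move=> m s; rewrite -val_eqE /= inordK//; lia.
- by move=> m j s; exact: Av_lift_132_123.
- move=> m s d _; rewrite /stat_132_123 pdesc_lift0 lift_perm_id.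
  have -> : (s ord0 < (if d then inord m else ord_max : 'I_m.+2)) =
            ~~ d || (s ord0 != ord_max).
    rewrite -val_eqE /=; have := ltn_ord (s ord0).
    by case: d => /=; rewrite ?inordK//; lia.
  have -> : ((if d then inord m else ord_max : 'I_m.+2) == ord_max) = ~~ d.
    by case: d; rewrite ?eqxx// -val_eqE /= inordK//; lia.
  rewrite rcons_cons /=.
  (* If [s] starts with its maximum, putting the second largest value in front creates an ascent
     before a descent: two changes, one of which offsets the lost indicator. *)
  have [s0|s0] := eqVneq (s ord0) ord_max; last by rewrite orbT; case: d; lia.
  have := changes_head (pdesc_max s0).
  by case: d => /=; lia.
Qed.

Lemma LAS_132_123 n (s : 'S_n.+1) :
  (LAS s <= stat_132_123 s + 3) && (stat_132_123 s <= LAS s + 3).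
Proof.
rewrite LAS_pdesc /stat_132_123 changes_rcons.
have := changes_le true false (pdesc s); have := changes_le false true (pdesc s).
by case: eqP => _ /=; case: (last _ _) => /=; lia.
Qed.

(** Starting from the head of the word makes a prepended bit count exactly when it differs from that
    head; the final [false] matches the default head, so this also holds for the empty word. *)
Definition stat_132_213 n (s : 'S_n.+1) : nat :=
  changes (head false (pdesc s)) (rcons (pdesc s) false).

Lemma sum_132_213 (R : comRingType) n (F : nat -> R) :
  (\sum_(s in Av [set p132; p213]%SET n.+1) F (stat_132_213 s) =
   \sum_(k < n.+1) 'C(n, k)%:R * F (stat_132_213 (1%g : 'S_1) + k)%N)%R.
Proof.
have v_in m (s : 'S_m.+1) : (inord (s ord0) : 'I_m.+2) = s ord0 :> nat.
  by rewrite inordK// ltnS ltnW.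
apply: (@sum_stat_lift R (fun n => Av [set p132; p213]%SET n.+1)
  (fun n => ord0) (fun n _ => ord_max) (fun n s => inord (s ord0))
  (fun n s => head false (pdesc s))).
- exact: Av1.
- by move=> m s; rewrite -val_eqE /= v_in; have := ltn_ord (s ord0); lia.
- by move=> m j s; exact: Av_lift_132_213.
- move=> m s d _; rewrite /stat_132_213 pdesc_lift0.
  have -> : (s ord0 < (if d then ord_max else inord (s ord0) : 'I_m.+2)) = d.
    by case: d => /=; rewrite ?v_in ?ltnn ?ltn_ord.
  rewrite rcons_cons /= eqxx add0n addnC.
  by case: (pdesc s) => [|b l] /=; rewrite ?eqxx ?addn0.
Qed.

Lemma LAS_132_213 n (s : 'S_n.+1) :
  (LAS s <= stat_132_213 s + 3) && (stat_132_213 s <= LAS s + 3).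
Proof.
rewrite LAS_pdesc /stat_132_213 changes_rcons; set a := head _ _.
have := changes_le a false (pdesc s); have := changes_le false a (pdesc s).
by case: (a); case: (last _ _) => /=; lia.
Qed.

End Classes.

(** * Asymptotics of the longest alternating subsequence *)

Section BinomialLAS.
Variables (R : realType) (T : {set 'S_3}) (stat : forall n, 'S_n.+1 -> nat).
Variables (c0 C : nat).
Hypothesis sum_statE : forall n (F : nat -> R),
  \sum_(s in Av T n.+1) F (stat s) = \sum_(k < n.+1) 'C(n, k)%:R * F (c0 + k)%N.
Hypothesis LAS_stat : forall n (s : 'S_n.+1),
  (LAS s <= stat s + C)%N && (stat s <= LAS s + C)%N.

(** Under the uniform measure on [Av T n.+1], [S] is binomial with parameters [n] and 1/2. *)
Let S n (s : 'S_n.+1) : R := (stat s)%:R - c0%:R.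
Let D : R := C%:R + c0%:R.

Let D0 : 0 <= D. Proof. by rewrite addr_ge0. Qed.

Let cardA n : #|Av T n.+1|%:R = 2 ^+ n :> R.
Proof.
have := sum_statE n (fun=> 1); rewrite sumr_const => ->.
rewrite -[RHS]mul1r -[X in _ = X * _](sum_binp R n) mulr_suml; apply: eq_bigr => k _.
by rewrite /binp divfK ?mulr1// expf_neq0.
Qed.

Let cardA_gt0 n : (0 < #|Av T n.+1|)%N.
Proof. by rewrite -(ltr_nat R) cardA exprn_gt0. Qed.

Let mean_statE n (G : R -> R) :
  unif_mean (Av T n.+1) (fun s => G (S s)) = \sum_(k < n.+1) binp R n k * G k%:R.
Proof.
rewrite /unif_mean (sum_statE n (fun k => G (k%:R - c0%:R))) cardA mulr_suml.
apply: eq_bigr => k _; rewrite /binp natrD addrAC subrr add0r; ring.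
Qed.

Let mean_S n : unif_mean (Av T n.+1) (@S n) = n%:R / 2.
Proof.
rewrite (mean_statE n id).
have := sum_binp_mean R n; under eq_bigr do rewrite mulrBr.
rewrite sumrB -mulr_suml sum_binp mul1r => /eqP; rewrite subr_eq0 => /eqP <-.
rewrite mulr_suml; apply: eq_bigr => k _; by field.
Qed.

Let var_S n :
  unif_mean (Av T n.+1) (fun s => (S s - unif_mean (Av T n.+1) (@S n)) ^+ 2) =
  n%:R / 4.
Proof.
rewrite mean_S (mean_statE n (fun x => (x - n%:R / 2) ^+ 2)).
rewrite -[X in _ = X / 4](sum_binp_var R n) mulr_suml; apply: eq_bigr => k _.
by field.
Qed.

Let S_dist n (s : 'S_n.+1) : `|LASr R s - S s| <= D.
Proof.
have /andP[h1 h2] := LAS_stat s.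
move: h1 h2; rewrite -!(ler_nat R) !natrD /LASr /S /D ler_norml => h1 h2.
have : 0 <= c0%:R :> R by []; lra.
Qed.

Lemma mean_LAS_bound n : `|mean_LAS R T n.+1 - n%:R / 2| <= D.
Proof. by rewrite -mean_S; apply: unif_mean_dist => // s _. Qed.

(** [unif_var_perturb] with weight [r = sqrt n] bounds the variance error by
    [5 / 2 * D * r + 4 * D ^+ 2]; dividing by the sum of the deviations, at least [r / 2], leaves a
    constant. *)
Lemma sd_LAS_bound n : (0 < n)%N ->
  `|sd_LAS R T n.+1 - Num.sqrt n%:R / 2| <= 5 * D + 8 * D ^+ 2.
Proof.
move=> n0; set r := Num.sqrt n%:R.
have r0 : 0 < r by rewrite sqrtr_gt0 ltr0n.
have r1 : 1 <= r by rewrite -[leLHS]sqrtr1 ler_wsqrtr// ler1n.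
have rE : r ^+ 2 = n%:R by rewrite sqr_sqrtr.
have := @unif_var_perturb R _ _ (cardA_gt0 n) (@LASr R n.+1) (@S n) D r r0 D0
  (fun s _ => S_dist s).
rewrite var_S /sd_LAS /unif_sd -/(mean_LAS R T n.+1).
set v := unif_mean _ _ => vB.
have v0 : 0 <= v.
  rewrite -(unif_mean_cst (cardA_gt0 n) 0); apply: ler_unif_mean => // s _.
  exact: sqr_ge0.
have {}vB : `|v - (r / 2) ^+ 2| <= 5 / 2 * D * r + 4 * D ^+ 2.
  rewrite exprMn exprVn rE (_ : 2 ^+ 2 = 4); last by ring.
  apply: (le_trans vB); rewrite -rE lerD2r.
  rewrite [leLHS](_ : _ = 5 / 2 * D * r)//.
  by field; rewrite gt_eqF.
have sv0 : 0 <= Num.sqrt v by exact: sqrtr_ge0.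
rewrite -(ler_pM2r (_ : 0 < r / 2)); last by lra.
apply: (@le_trans _ _ `|v - (r / 2) ^+ 2|).
  have -> : v - (r / 2) ^+ 2 =
      (Num.sqrt v - r / 2) * (Num.sqrt v + r / 2).
    by rewrite -{1}(sqr_sqrtr v0); ring.
  rewrite normrM ler_wpM2l// ger0_norm; lra.
apply: (le_trans vB).
have -> : (5 * D + 8 * D ^+ 2) * (r / 2) = 5 / 2 * D * r + 4 * D ^+ 2 * r by field.
by rewrite lerD2l ler_peMr// mulr_ge0// sqr_ge0.
Qed.

Let K : R := 5 * D + 8 * D ^+ 2.

Let prob_S n (y : R) : unif_prob R (Av T n.+1) (fun s => S s <= y) =
  \sum_(k < n.+1 | k%:R <= y) binp R n k.
Proof.
rewrite unif_probE (mean_statE n (fun x => (nat_of_bool (x <= y))%:R)) [RHS]big_mkcond.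
by apply: eq_bigr => k _; case: ifP; rewrite ?mulr1 ?mulr0.
Qed.

Local Open Scope classical_set_scope.

Lemma LAS_normal_error (x : R) : exists B : R, \forall n \near \oo,
  `|unif_prob R (Av T n.+1)
      (fun s => (LASr R s - mean_LAS R T n.+1) / sd_LAS R T n.+1 <= x)
    - gauss_cdf x| <= B / Num.sqrt n%:R.
Proof.
have [B0 B0P] := binp_cdf (`|x| + 1).
(* [B1 / r] bounds the shift of the standardised cut due to the errors in the mean, in the deviation
   and in [S]. It is at most 1 for large [n], hence the window [|x| + 1]. *)
pose B1 := 4 * D + 2 * `|x| * K.
exists (B0 + B1); near=> n.
have n0 : (0 < n)%N by near: n; exact: nbhs_infty_gt.
have nM : (`|x| + 1) ^+ 2 < n%:R by near: n; exact: nbhs_infty_gtr.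
have rB : B1 <= Num.sqrt n%:R.
  by near: n; have /cvgryPge := @cvg_sqrt_nat R; exact.
have rK : 2 * K + 1 <= Num.sqrt n%:R.
  by near: n; have /cvgryPge := @cvg_sqrt_nat R; exact.
move: rB rK; set r := Num.sqrt n%:R => rB rK.
have r0 : 0 < r by rewrite sqrtr_gt0 ltr0n.
have sdB := sd_LAS_bound n0; have mB := mean_LAS_bound n.
move: sdB mB; rewrite -/r -/K.
set sd := sd_LAS _ _ _; set m := mean_LAS _ _ _ => sdB mB.
have sd0 : 0 < sd by move: sdB; rewrite ler_norml => /andP[]; lra.
pose y := m + x * sd.
have LE (s : 'S_n.+1) : ((LASr R s - m) / sd <= x) = (LASr R s <= y).
  by rewrite ler_pdivrMr// lerBlDl.
have bound e : `|e| <= D ->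
    `|\sum_(k < n.+1 | k%:R <= y + e) binp R n k - gauss_cdf x|
      <= (B0 + B1) / r.
  move=> eD; set t := ((y + e) *+ 2 - n%:R) / r.
  have tx : `|t - x| <= B1 / r.
    have -> : t - x = (2 * (m - n%:R / 2) + 2 * e + 2 * x * (sd - r / 2)) / r.
      by rewrite /t /y; field; rewrite gt_eqF.
    rewrite normrM [X in _ * X]ger0_norm ?invr_ge0 ?(ltW r0)//.
    rewrite ler_wpM2r ?invr_ge0 ?(ltW r0)//.
    apply: (le_trans (ler_normD _ _)); rewrite /B1; apply: lerD; last first.
      by rewrite !normrM (@ger0_norm _ 2)// ler_wpM2l// mulr_ge0.
    apply: (le_trans (ler_normD _ _)); rewrite !normrM (@ger0_norm _ 2)//; lra.
  have tx1 : `|t - x| <= 1.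
    by apply: (le_trans tx); rewrite ler_pdivrMr// mul1r.
  have tM : `|t| <= `|x| + 1.
    by rewrite -{1}(subrK x t) addrC (le_trans (ler_normD _ _))// lerD2l.
  apply: (le_trans (ler_distD (gauss_cdf t) _ _)); rewrite mulrDl; apply: lerD.
    exact: B0P.
  apply: le_trans tx; have [tlx|xt] := leP t x.
    rewrite distrC (le_trans (gauss_cdf_lip tlx))// -normrN opprB.
    exact: ler_norm.
  by rewrite (le_trans (gauss_cdf_lip (ltW xt)))// ler_norm.
(* The event for [LAS] is squeezed between those for [S] at the cuts [y - D] and [y + D]. *)
have lo : \sum_(k < n.+1 | k%:R <= y - D) binp R n k <=
    unif_prob R (Av T n.+1) (fun s => (LASr R s - m) / sd <= x).
  rewrite -prob_S; apply: ler_unif_prob => // s _; rewrite LE.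
  by have := S_dist s; rewrite ler_norml => /andP[]; lra.
have hi : unif_prob R (Av T n.+1) (fun s => (LASr R s - m) / sd <= x) <=
    \sum_(k < n.+1 | k%:R <= y + D) binp R n k.
  rewrite -prob_S; apply: ler_unif_prob => // s _; rewrite LE.
  by have := S_dist s; rewrite ler_norml => /andP[]; lra.
have := bound D; have := bound (- D).
rewrite normrN (ger0_norm D0) => /(_ (lexx _)) b1 /(_ (lexx _)) b2.
move: b1 b2; rewrite !ler_norml => /andP[b1 _] /andP[_ b2].
by apply/andP; split; lra.
Unshelve. all: by end_near. Qed.

Theorem binomial_LAS_asymptotics :
  [/\ LAS_asymp_normal R T,
      asymp_equiv (mean_LAS R T) (fun n => n%:R / 2) &
      asymp_equiv (sd_LAS R T) (fun n => Num.sqrt n%:R / 2)].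
Proof.
have shift (P : nat -> Prop) : (\forall n \near \oo, P n.+1) -> \forall n \near \oo, P n.
  by move=> [N _ NP]; exists N.+1 => // -[//|n] /= Nn; exact: NP.
have half (b : nat -> R) : (b n @[n --> \oo] --> +oo) ->
    b n / 2 @[n --> \oo] --> +oo.
  move=> bpo; apply/cvgryPge => M; near=> n.
  rewrite ler_pdivlMr//; near: n; move/cvgryPge: bpo; exact.
split.
- move=> x _; rewrite -cvg_shiftS /=; have [B BP] := LAS_normal_error x.
  exact: (cvg_bounded_error (@cvg_sqrt_nat R) BP).
(* The bounds compare index [n.+1] with [n]; the added 1 absorbs the shift, here and for the
   deviation. *)
- apply: (@asymp_equiv_bounded R _ _ (D + 1)).
    by apply: half; exact: cvgr_idn.
  apply: shift; near=> n; rewrite -natr1.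
  have := mean_LAS_bound n; rewrite !ler_norml => /andP[h1 h2].
  by apply/andP; split; lra.
- apply: (@asymp_equiv_bounded R _ _ (K + 1)).
    by apply: half; exact: cvg_sqrt_nat.
  apply: shift; near=> n.
  have n0 : (0 < n)%N by near: n; exact: nbhs_infty_gt.
  have := sd_LAS_bound n0; rewrite -/K !ler_norml => /andP[h1 h2].
  have s1 : Num.sqrt n%:R <= Num.sqrt n.+1%:R :> R by rewrite ler_wsqrtr// ler_nat.
  have s2 : Num.sqrt n.+1%:R <= Num.sqrt n%:R + 1 :> R.
    have q0 : 0 <= Num.sqrt n%:R :> R by exact: sqrtr_ge0.
    rewrite -(@ler_pXn2r _ 2) ?nnegrE ?addr_ge0 ?sqrtr_ge0//.
    rewrite sqr_sqrtr// -natr1 sqrrD sqr_sqrtr// expr1n mulr1 lerD2r lerDl.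
    exact: mulrn_wge0.
  by apply/andP; split; lra.
Unshelve. all: by end_near. Qed.

End BinomialLAS.

Theorem theorem2p3 (R : realType) (T : {set 'S_3}) (hT : #|T| = 2%N) :
  [/\ (* (a) *)
      T = [set p132; p321]%SET ->
        forall (n : nat) (s : 'S_n), s \in Av T n -> (LAS s <= 3)%N,
      (* (b) *)
      (T = [set p132; p231]%SET ->
        forall (n : nat) (s : 'S_n), s \in Av T n -> (LAS s <= 3)%N) /\
      (T = [set p132; p312]%SET ->
        [/\ LAS_asymp_normal R T,
            asymp_equiv (mean_LAS R T) (fun n => n%:R / 2) &
            asymp_equiv (sd_LAS R T) (fun n => Num.sqrt n%:R / 2)]),
      (* (c) *)
      T = [set p132; p123]%SET ->
        [/\ LAS_asymp_normal R T,
            asymp_equiv (mean_LAS R T) (fun n => n%:R / 2) &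
            asymp_equiv (sd_LAS R T) (fun n => Num.sqrt n%:R / 2)] &
      (* (d) *)
      T = [set p132; p213]%SET ->
        [/\ LAS_asymp_normal R T,
            asymp_equiv (mean_LAS R T) (fun n => n%:R / 2) &
            asymp_equiv (sd_LAS R T) (fun n => Num.sqrt n%:R / 2)]].
Proof.
split; [|split| |] => ->.
- exact: LAS_132_321.
- exact: LAS_132_231.
- apply: (binomial_LAS_asymptotics (C := 1)); first exact: sum_132_312.
  by move=> n s; rewrite LAS_132_312; lia.
- apply: (binomial_LAS_asymptotics (C := 3)); first exact: sum_132_123.
  exact: LAS_132_123.
- apply: (binomial_LAS_asymptotics (C := 3)); first exact: sum_132_213.
  exact: LAS_132_213.
Qed.
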